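(* Finite presentability is unstable under strongly exponential orbit equivalence: there exist finitely generated groups $\Gamma$ and $\Lambda$, with $\Lambda$ finitely presented and $\Gamma$ not finitely presented, admitting an orbit equivalence coupling that is strongly $\exp$-integrable both from $\Gamma$ to $\Lambda$ and from $\Lambda$ to $\Gamma$. In particular, finite presentability is unstable under $\mathrm L^{<\infty}$ orbit equivalence: there exist finitely generated groups $\Gamma$ and $\Lambda$, with $\Lambda$ finitely presented and $\Gamma$ not finitely presented, admitting an orbit equivalence coupling that is $(\mathrm L^p,\mathrm L^p)$-integrable for all $1\le p<\infty$.
   Context: An orbit equivalence coupling between $\Gamma=\langle S_\Gamma\rangle$ and $\Lambda=\langle S_\Lambda\rangle$ ($S_\Gamma,S_\Lambda$ finite symmetric) is a standard probability space $(X,\mu)$ with free (up to null sets) measure-preserving actions of $\Gamma$ and $\Lambda$ such that $\Gamma\cdot x=\Lambda\cdot x$ for almost every $x\in X$. For $y\in\Lambda\cdot x$, $d_{S_\Lambda}(x,y)$ is the minimal word length of $\lambda\in\Lambda$ with $y=\lambda\cdot x$; $d_{S_\Gamma}$ is defined similarly. The coupling is strongly $\exp$-integrable from $\Gamma$ to $\Lambda$ if for every $\varepsilon>0$ there are $\delta>0$ and $C>0$ such that for every $\gamma\in\Gamma$, $\int_X\exp\left(\delta\, d_{S_\Lambda}(x,\gamma\cdot x)\right)d\mu(x)\le C\exp\left(\varepsilon|\gamma|_{S_\Gamma}\right)$, where $|\cdot|_{S_\Gamma}$ is word length; from $\Lambda$ to $\Gamma$ the definition is symmetric. It is $(\mathrm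 L^p,\mathrm L^p)$-integrable if $\int_Xd_{S_\Lambda}(x,\gamma\cdot x)^p\,d\mu(x)<\infty$ for all $\gamma\in\Gamma$ and $\int_Xd_{S_\Gamma}(x,\lambda\cdot x)^p\,d\mu(x)<\infty$ for all $\lambda\in\Lambda$. *)

(* Defs.v *)
From HB Require Import structures.
From mathcomp Require Import all_boot all_order all_algebra.
From mathcomp Require Import all_classical all_reals all_analysis.

Set Implicit Arguments.
Unset Strict Implicit.
Unset Printing Implicit Defensive.

Import Order.TTheory GRing.Theory Num.Theory.

Local Open Scope classical_set_scope.

Section Groups.
Variable G : groupType.
Implicit Types (S H : set G) (g : G).
Local Open Scope group_scope.

Definition is_subgroup H :=
  [/\ H 1, forall g h, H g -> H h -> H (g * h) & forall g, H g -> H g^-1].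

Definition generates S := smallest is_subgroup S = setT.

Record finite_symmetric_generating S : Prop := {
  fsg_finite : finite_set S;
  fsg_symmetric : forall g, S g -> S g^-1;
  fsg_generates : generates S }.

(* Words in the generators and their formal inverses: the letter [(i, false)]
   stands for the [i]-th generator and [(i, true)] for its inverse. *)
Definition word n := seq ('I_n * bool).

Definition eval_word n (x : 'I_n -> G) (w : word n) : G :=
  \prod_(l <- w) (if l.2 then (x l.1)^-1 else x l.1).

End Groups.

(* The congruence on words whose quotient is the group presented by the
   generators ['I_n] and the relators [rels]. *)
Inductive presented_eq n (rels : seq (word n)) : word n -> word n -> Prop :=
| presented_refl w : presented_eq rels w w
| presented_sym v w : presented_eq rels v w -> presented_eq rels w v
| presented_trans u v w :
    presented_eq rels u v -> presented_eq rels v w -> presented_eq rels u w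
| presented_cancel u v (i : 'I_n) (b : bool) :
    presented_eq rels (u ++ [:: (i, b); (i, ~~ b)] ++ v) (u ++ v)
| presented_relator u v r :
    r \in rels -> presented_eq rels (u ++ r ++ v) (u ++ v).

(* Evaluation at [x] induces an isomorphism from the presented group to [G]. *)
Definition finitely_presented (G : groupType) : Prop :=
  exists (n : nat) (rels : seq (word n)) (x : 'I_n -> G),
    (forall g : G, exists w, eval_word x w = g) /\
    (forall v w, eval_word x v = eval_word x w <-> presented_eq rels v w).

Section WordLength.
Variable R : realType.
Local Open Scope ereal_scope.

(* Word length as an extended real: an infimum over a set of naturals, hence a
   minimum, equal to [+oo] only when [g] is not a product of elements of [S]. *)
Definition word_length (G : groupType) (S : set G) (g : G) : \bar R :=
  ereal_inf [set (size w)%:R%:E | w in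
    [set w : seq G | (forall s, s \in w -> S s) /\ (\prod_(s <- w) s)%g = g]].

(* [+oo] when [y] is not in the orbit of [x]. *)
Definition orbit_dist (G : groupType) (S : set G) (X : Type)
    (a : G -> X -> X) (x y : X) : \bar R :=
  ereal_inf [set word_length S g | g in [set g | a g x = y]].

End WordLength.

(* The Borel isomorphism [f] identifies [X] with a complete separable metric
   space. *)
Definition standard_borel (R : realType) d (X : measurableType d) : Prop :=
  exists (M : metricType R) (f : X -> M),
    [/\ exists2 D : set M, countable D & dense D,
        forall F : set_system M, ProperFilter F -> cauchy F ->
          exists l : M, F --> l,
        bijective f &
        forall A : set X, measurable A <-> <<s @open M >> (f @` A)].

Section Actions.
Variables (R : realType) (d : measure_display) (X : measurableType d).
Variables (mu : probability X R) (G : groupType) (a : G -> X -> X).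

Record pmp_action : Prop := {
  pmp_act1 : forall x, a 1%g x = x;
  pmp_actM : forall g h x, a (g * h)%g x = a g (a h x);
  pmp_measurable : forall g, measurable_fun setT (a g);
  pmp_preserving : forall g A, measurable A -> mu (a g @^-1` A) = mu A }.

Definition ae_free : Prop :=
  \forall x \ae mu, forall g : G, a g x = x -> g = 1%g.

End Actions.

Record oe_coupling (R : realType) (G L : groupType) := OECoupling {
  oe_display : measure_display;
  oe_space : measurableType oe_display;
  oe_measure : probability oe_space R;
  oe_actl : G -> oe_space -> oe_space;
  oe_actr : L -> oe_space -> oe_space;
  oe_standard : standard_borel R oe_space;
  oe_pmpl : pmp_action oe_measure oe_actl;
  oe_pmpr : pmp_action oe_measure oe_actr;
  oe_freel : ae_free oe_measure oe_actl;
  oe_freer : ae_free oe_measure oe_actr;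
  oe_orbits : \forall x \ae oe_measure,
    range (oe_actl^~ x) = range (oe_actr^~ x) }.

Section Integrability.
Variables (R : realType) (d : measure_display) (X : measurableType d).
Variable mu : probability X R.
Local Open Scope ereal_scope.

(* from the group acting by [a] to the group acting by [b] *)
Definition strongly_exp_integrable_from_to (G L : groupType)
    (SG : set G) (SL : set L) (a : G -> X -> X) (b : L -> X -> X) : Prop :=
  forall eps : R, (0 < eps)%R ->
    exists delta C : R, [/\ (0 < delta)%R, (0 < C)%R &
      forall g : G,
        \int[mu]_x expeR (delta%:E * orbit_dist R SL b x (a g x)) <=
          C%:E * expeR (eps%:E * word_length R SG g)].

Definition Lp_integrable_from_to (G L : groupType)
    (SL : set L) (a : G -> X -> X) (b : L -> X -> X) (p : R) : Prop :=
  forall g : G, \int[mu]_x (orbit_dist R SL b x (a g x) `^ p) < +oo.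

End Integrability.

Section CouplingIntegrability.
Variables (R : realType) (G L : groupType) (SG : set G) (SL : set L).
Variable c : oe_coupling R G L.

Definition strongly_exp_integrable_lr : Prop :=
  strongly_exp_integrable_from_to (oe_measure c) SG SL
    (@oe_actl _ _ _ c) (@oe_actr _ _ _ c).

Definition strongly_exp_integrable_rl : Prop :=
  strongly_exp_integrable_from_to (oe_measure c) SL SG
    (@oe_actr _ _ _ c) (@oe_actl _ _ _ c).

Definition LpLp_integrable (p : R) : Prop :=
  Lp_integrable_from_to (oe_measure c) SL
    (@oe_actl _ _ _ c) (@oe_actr _ _ _ c) p /\
  Lp_integrable_from_to (oe_measure c) SG
    (@oe_actr _ _ _ c) (@oe_actl _ _ _ c) p.

End CouplingIntegrability.

(* Main.v *)
Require Import Defs.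
From HB Require Import structures.
From mathcomp Require Import all_boot all_order all_algebra finmap.
From mathcomp Require Import all_classical all_reals all_analysis.
From mathcomp Require Import measurable_realfun.
From mathcomp Require Import zify ring lra.
From Stdlib Require Setoid Morphisms.

(* Take for [G] the lamplighter group (Z/2) wr Z and for [L] the group
   BS(1,2) = Z[1/2] x| Z, both acting on the two-sided coin-tossing space
   {0,1}^Z.  The generator [t] of either group acts by the shift.  A finite
   configuration of lamps acts by adding it digitwise modulo 2, whereas c * 2^s
   acts by adding it with carries, as a 2-adic integer in the digits at positions
   >= s.  Unless a carry propagates forever, which almost surely does not happen,
   the latter changes finitely many digits, so both actions have the same orbits.

   A lamplighter generator always acts as some generator of BS(1,2), so one
   direction is Lipschitz.  Conversely, an element of length N in BS(1,2) is
   (c / 2^N, m) with |c| <= 4^N and |m| <= N: adding it changes digits only in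
   [-N, N + k + 2), where the length k of the terminal carry has a geometric law
   that does not depend on N; hence the displacement in the lamplighter group is
   at most 7 N + 3 k + 6.  This gives strong exponential integrability, which in
   turn implies integrability of all powers.

   The lamplighter group is not finitely presented: it has central extensions by
   Z/2 in which the lamps at distance N no longer commute, while any given
   relator still holds as soon as N is large. *)

Set Implicit Arguments.
Unset Strict Implicit.
Unset Printing Implicit Defensive.

Import Order.TTheory GRing.Theory Num.Theory.
Import numFieldNormedType.Exports.

Local Open Scope classical_set_scope.
Local Open Scope ring_scope.

(** * Presented groups *)

Section PresentedWords.
Variables (n : nat) (rels : seq (word n)).
Notation "v ~~ w" := (presented_eq rels v w) (at level 70).

#[export] Instance presented_eq_equivalence :
  RelationClasses.Equivalence (presented_eq rels).
Proof.
split; [exact: presented_refl | exact: presented_sym | exact: presented_trans].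
Qed.

Lemma presented_catl u v w : v ~~ w -> u ++ v ~~ u ++ w.
Proof.
elim=> {v w} [w|v w _|a v w _ IH1 _ IH2|a b i c|a b r rin].
- exact: presented_refl.
- exact: presented_sym.
- exact: presented_trans IH1 IH2.
- by rewrite !(catA u); apply: presented_cancel.
- by rewrite !(catA u); apply: presented_relator.
Qed.

Lemma presented_catr u v w : v ~~ w -> v ++ u ~~ w ++ u.
Proof.
elim=> {v w} [w|v w _|a v w _ IH1 _ IH2|a b i c|a b r rin].
- exact: presented_refl.
- exact: presented_sym.
- exact: presented_trans IH1 IH2.
- by rewrite -!catA; apply: presented_cancel.
- by rewrite -!catA; apply: presented_relator.
Qed.

#[export] Instance presented_cat_proper :
  Morphisms.Proper (Morphisms.respectful (presented_eq rels)
    (Morphisms.respectful (presented_eq rels) (presented_eq rels))) cat.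
Proof.
move=> v v' vv' w w' ww'; transitivity (v ++ w').
  exact: presented_catl.
exact: presented_catr.
Qed.

#[export] Instance presented_cons_proper :
  Morphisms.Proper (Morphisms.respectful eq
    (Morphisms.respectful (presented_eq rels) (presented_eq rels))) cons.
Proof. by move=> l _ <- v w; exact: (@presented_catl [:: l]). Qed.

Lemma presented_consK i b w : (i, b) :: (i, ~~ b) :: w ~~ w.
Proof. exact: (@presented_cancel _ rels [::] w i b). Qed.

Lemma presented_consNK i w : (i, true) :: (i, false) :: w ~~ w.
Proof. exact: (presented_consK i true). Qed.

Lemma presented_eq_eval (G : groupType) (x : 'I_n -> G) :
  (forall r, r \in rels -> eval_word x r = 1%g) ->
  forall v w, v ~~ w -> eval_word x v = eval_word x w.
Proof.
move=> rel1 v w.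
elim=> {v w} [//|v w _ //|a v w _ -> //|a b i c|a b r /rel1 rr].
- rewrite /eval_word !big_cat !big_cons big_nil /=.
  by case: c => /=; rewrite mulg1 ?mulVg ?mulgV mul1g.
- by rewrite /eval_word !big_cat /= -/(eval_word x r) rr mul1g.
Qed.

End PresentedWords.

#[export] Hint Resolve presented_refl : core.

Lemma eval_word_cat n (G : groupType) (x : 'I_n -> G) v w :
  eval_word x (v ++ w) = (eval_word x v * eval_word x w)%g.
Proof. by rewrite /eval_word big_cat. Qed.

Lemma eval_word_cons n (G : groupType) (x : 'I_n -> G) l w :
  eval_word x (l :: w) =
  ((if l.2 then (x l.1)^-1 else x l.1) * eval_word x w)%g.
Proof. by rewrite /eval_word big_cons. Qed.

(** * The lamplighter group is not finitely presented *)

Section Fset.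
Local Open Scope fset_scope.
Local Open Scope ring_scope.
Implicit Types A B C : {fset int}.

Definition symdiff A B : {fset int} :=
  [fset i in A `|` B | (i \in A) (+) (i \in B)].
Definition translate (m : int) A : {fset int} := [fset i + m | i in A].

Lemma in_symdiff A B i : (i \in symdiff A B) = (i \in A) (+) (i \in B).
Proof. by rewrite !inE /=; case: (i \in A) (i \in B) => [] []. Qed.

Lemma in_translate m A i : (i \in translate m A) = (i - m \in A).
Proof.
apply/imfsetP/idP => /= [[j jA ->]|iA]; first by rewrite addrK.
by exists (i - m) => //; rewrite subrK.
Qed.

Definition in_lamps := (in_symdiff, in_translate, inE).

(* The parity of the number of pairs in [A * B] at distance [N]: a bilinear,
   translation invariant form, which vanishes on given sets for large [N]. *)
Definition crossing (N : nat) A B : bool :=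
  \big[addb/false]_(i <- A) (i + N%:Z \in B).

(** Summing over a common superset [U] puts different first arguments on one index set, which is
    what additivity in that argument requires. *)
Lemma crossing_incl N A B U : A `<=` U ->
  crossing N A B = \big[addb/false]_(i <- U) ((i \in A) && (i + N%:Z \in B)).
Proof.
move=> AU; rewrite -(big_fset_incl _ AU) /crossing.
  by apply: eq_big_seq => i ->.
by move=> i _ /negPf ->.
Qed.

Lemma crossing_symdiffl N A B C :
  crossing N (symdiff A B) C = crossing N A C (+) crossing N B C.
Proof.
rewrite (@crossing_incl N (symdiff A B) C (A `|` B)); last first.
  apply/fsubsetP => i; rewrite in_symdiff !inE.
  by case: (i \in A) (i \in B) => [] [].
rewrite (@crossing_incl N A C (A `|` B)) ?fsubsetUl //.
rewrite (@crossing_incl N B C (A `|` B)) ?fsubsetUr // -big_split /=.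
by apply: eq_bigr => i _; rewrite in_symdiff andb_addl.
Qed.

Lemma crossing_symdiffr N A B C :
  crossing N A (symdiff B C) = crossing N A B (+) crossing N A C.
Proof.
by rewrite /crossing -big_split; apply: eq_bigr => i _; rewrite in_symdiff.
Qed.

Lemma crossing_translate N m A B :
  crossing N (translate m A) (translate m B) = crossing N A B.
Proof.
rewrite /crossing big_imfset /=; last by move=> i j _ _ /addIr.
by apply: eq_bigr => i _; rewrite in_translate addrAC addrK.
Qed.

Lemma crossing_near A B : \forall N \near \oo, crossing N A B = false.
Proof.
(* [K] dominates [|i| + |j|] for all [i] in [A] and [j] in [B], whereas [i + N = j] would force
   [N <= |i| + |j|]. *)
pose K := (\sum_(i <- A) `|i| + \sum_(j <- B) `|j|)%N.
exists K.+1 => // N /= KN; rewrite /crossing big_seq big1 // => i iA.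
apply/negP => jB; move: KN.
rewrite /K (big_fsetD1 i) //= [in X in (_ + X)%N](big_fsetD1 (i + N%:Z)) //=.
move: (\sum_(_ <- _) _)%N (\sum_(_ <- _) _)%N => a b; lia.
Qed.

End Fset.

(** * The lamplighter group and its twisted central extensions *)

Definition lamp : Type := ({fset int} * int)%type.
HB.instance Definition _ := Choice.on lamp.

Section LampGroup.
Implicit Types g h k : lamp.

Definition lamp_one : lamp := (fset0, 0).
Definition lamp_mul g h : lamp :=
  (symdiff g.1 (translate g.2 h.1), g.2 + h.2).
Definition lamp_inv g : lamp := (translate (- g.2) g.1, - g.2).

Fact lamp_mulA : associative lamp_mul.
Proof.
move=> [A m] [B n] [C p]; congr pair => /=; last by rewrite addrA.
by apply/fsetP => i; rewrite !in_lamps addbA opprD addrA.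
Qed.

Fact lamp_mul1g : left_id lamp_one lamp_mul.
Proof.
move=> [A m]; congr pair => /=; last by rewrite add0r.
by apply/fsetP => i; rewrite !in_lamps subr0.
Qed.

Fact lamp_mulg1 : right_id lamp_one lamp_mul.
Proof.
move=> [A m]; congr pair => /=; last by rewrite addr0.
by apply/fsetP => i; rewrite !in_lamps addbF.
Qed.

Fact lamp_mulVg : left_inverse lamp_one lamp_inv lamp_mul.
Proof.
move=> [A m]; congr pair => /=; last by rewrite addNr.
by apply/fsetP => i; rewrite !in_lamps addbb.
Qed.

Fact lamp_mulgV : right_inverse lamp_one lamp_inv lamp_mul.
Proof.
move=> [A m]; congr pair => /=; last by rewrite addrN.
by apply/fsetP => i; rewrite !in_lamps opprK subrK addbb.
Qed.

HB.instance Definition _ := isGroup.Build lamp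
  lamp_mulA lamp_mul1g lamp_mulg1 lamp_mulVg lamp_mulgV.

End LampGroup.

(* The central extension of the lamplighter group by Z/2 whose cocycle is
   [crossing N]; the lamps at 0 and [N] do not commute in it. *)
Definition twisted (N : nat) : Type := (lamp * bool)%type.
HB.instance Definition _ N := Choice.on (twisted N).

Section TwistedGroup.
Variable N : nat.
Implicit Types g h : twisted N.

Definition cocycle (g h : lamp) : bool :=
  crossing N g.1 (translate g.2 h.1).

(** The 2-cocycle identity, which is associativity in [twisted N]. It follows from bilinearity and
    translation invariance of [crossing]. *)
Lemma cocycleP (g h k : lamp) :
  cocycle h k (+) cocycle g (h * k)%g = cocycle g h (+) cocycle (g * h)%g k.
Proof.
rewrite /cocycle /= -(crossing_translate N g.2 h.1) crossing_symdiffl.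
have -> : translate g.2 (symdiff h.1 (translate h.2 k.1)) =
    symdiff (translate g.2 h.1) (translate (g.2 + h.2) k.1).
  by apply/fsetP => i; rewrite !in_lamps opprD addrA.
have -> : translate g.2 (translate h.2 k.1) = translate (g.2 + h.2) k.1.
  by apply/fsetP => i; rewrite !in_lamps opprD addrA.
by rewrite crossing_symdiffr addbC -addbA.
Qed.

Lemma cocycle1g (h : lamp) : cocycle 1%g h = false.
Proof. by rewrite /cocycle /crossing big_seq_fset0. Qed.

Lemma cocycleg1 (g : lamp) : cocycle g 1%g = false.
Proof.
by rewrite /cocycle /crossing big1 // => i _; rewrite in_translate inE.
Qed.

Definition twisted_one : twisted N := (1%g, false).
Definition twisted_mul g h : twisted N :=
  ((g.1 * h.1)%g, g.2 (+) h.2 (+) cocycle g.1 h.1).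
Definition twisted_inv g : twisted N :=
  ((g.1^-1)%g, g.2 (+) cocycle g.1 (g.1^-1)%g).

Fact twisted_mulA : associative twisted_mul.
Proof.
move=> [g a] [h b] [k c]; congr pair => /=; first by rewrite mulgA.
rewrite -!addbA; congr addb; congr addb.
by rewrite cocycleP; case: c (cocycle g h) (cocycle (g * h)%g k) => [] [] [].
Qed.

Fact twisted_mul1g : left_id twisted_one twisted_mul.
Proof. by move=> [g a]; congr pair; rewrite /= ?mul1g // cocycle1g addbF. Qed.

Fact twisted_mulg1 : right_id twisted_one twisted_mul.
Proof.
by move=> [g a]; congr pair; rewrite /= ?mulg1 // cocycleg1 !addbF.
Qed.

Fact twisted_mulgV : right_inverse twisted_one twisted_inv twisted_mul.
Proof.
by move=> [g a]; congr pair; rewrite /= ?mulgV // addbA addbb addbb.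
Qed.

(** Purely formal from the right inverse law, applied to [g] and to its inverse; no cocycle has to
    be computed. *)
Fact twisted_mulVg : left_inverse twisted_one twisted_inv twisted_mul.
Proof.
move=> g; have := twisted_mulgV (twisted_inv g).
set h := twisted_inv g => hk.
by rewrite -[RHS]hk -[in RHS](twisted_mul1g (twisted_inv h))
   -(twisted_mulgV g) -/h -(twisted_mulA g) hk twisted_mulg1.
Qed.

HB.instance Definition _ := isGroup.Build (twisted N)
  twisted_mulA twisted_mul1g twisted_mulg1 twisted_mulVg twisted_mulgV.

Lemma eval_twisted n (x : 'I_n -> lamp) (w : word n) :
  (eval_word (fun i => (x i, false) : twisted N) w).1 = eval_word x w.
Proof.
elim: w => [|[i b] w IH]; first by rewrite /eval_word !big_nil.
by rewrite !eval_word_cons /= IH; case: b.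
Qed.

End TwistedGroup.

(** A fixed word involves finitely many cocycle values, each a [crossing N] of sets that do not
    depend on [N]; all of them vanish for large [N]. *)
Lemma eval_twisted_near n (x : 'I_n -> lamp) (w : word n) :
  \forall N \near \oo,
    eval_word (fun i => (x i, false) : twisted N) w = (eval_word x w, false).
Proof.
elim: w => [|[i b] w IH].
  by near=> N; rewrite /eval_word !big_nil.
near=> N; rewrite !eval_word_cons (near IH N) //.
congr pair; case: b => //=.
- rewrite addbF (_ : cocycle _ _ _ = false); last by near: N; exact: crossing_near.
  by near: N; exact: crossing_near.
- by near: N; exact: crossing_near.
Unshelve. all: by end_near. Qed.

Lemma lamp_not_finitely_presented : ~ finitely_presented lamp.
Proof.
move=> [n [rels [x [gen iso]]]].
have relN : \forall N \near \oo, forall r, r \in rels ->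
    eval_word (fun i => (x i, false) : twisted N) r = 1%g.
  have : forall r, r \in rels -> eval_word x r = 1%g.
    move=> r rin; rewrite (_ : 1%g = eval_word x [::]); last first.
      by rewrite /eval_word big_nil.
    apply/iso; have := @presented_relator n rels [::] [::] r rin.
    by rewrite cats0.
  elim: rels {gen iso} => [|r rels IH] rel1; first by near=> N.
  have {}IH := IH (fun u uin => rel1 u (mem_behead (s := r :: rels) uin)).
  near=> N => s; rewrite inE => /orP[/eqP -> | ]; last by move: s; near: N.
    transitivity ((eval_word x r, false) : twisted N).
      by near: N; exact: eval_twisted_near.
    by rewrite rel1 // mem_head.
have {relN}[N [N0 relN]] : exists N : nat, (0 < N)%N /\ forall r, r \in rels ->
    eval_word (fun i => (x i, false) : twisted N) r = 1%g.
  have [M _ MP] : \forall N \near \oo, (0 < N)%N /\ forall r, r \in rels ->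
    eval_word (fun i => (x i, false) : twisted N) r = 1%g.
    by near=> N; split; near: N => //; exact: nbhs_infty_gt.
  by exists M; apply: MP => /=.
pose a (i : int) : lamp := ([fset i]%fset, 0).
have [[v va] [w wa]] := (gen (a 0), gen (a N%:Z)).
(* The lamps at 0 and [N] commute in [lamp], so the relators imply that [v] and [w] commute. This
   consequence carries over to [twisted N], where the relators hold too. *)
have : presented_eq rels (v ++ w) (w ++ v).
  apply/iso; rewrite !eval_word_cat va wa; congr pair.
  by apply/fsetP => i; rewrite /= !in_lamps !subr0 addbC.
(* The [bool] components reduce to the two cocycle values of the lamps at 0 and [N]: true in one
   order ([0 + N = N]), false in the other ([N + N] is not 0, as [N > 0]). *)
move=> /(presented_eq_eval relN); rewrite !eval_word_cat => /(congr1 snd) /=.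
rewrite addbC [in RHS]addbC (addbC (_.2)) => /(can_inj (addbK _)).
rewrite !eval_twisted va wa /cocycle /crossing /= !big_seq_fset1.
rewrite !in_translate !inE add0r subr0 eqxx => /esym/eqP.
lia.
Unshelve. all: by end_near. Qed.

(** * The Baumslag-Solitar group BS(1,2) is finitely presented *)

(** The pair [(b, m)] stands for the affine map [q -> 2 ^ m * q + b], and the product is
    composition. *)
Definition affine : Type := (rat * int)%type.
HB.instance Definition _ := Choice.on affine.

Section AffineGroup.
Implicit Types g h k : affine.

Definition affine_one : affine := (0, 0).
Definition affine_mul g h : affine := (g.1 + 2 ^ g.2 * h.1, g.2 + h.2).
Definition affine_inv g : affine := (- (2 ^ (- g.2) * g.1), - g.2).

Fact affine_mulA : associative affine_mul.
Proof.
move=> [a m] [b n] [c p]; congr pair => /=; last by rewrite addrA.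
by rewrite expfzDr // mulrDr addrA mulrA.
Qed.

Fact affine_mul1g : left_id affine_one affine_mul.
Proof. by move=> [a m]; congr pair; rewrite /= !add0r ?mul1r. Qed.

Fact affine_mulg1 : right_id affine_one affine_mul.
Proof. by move=> [a m]; congr pair; rewrite /= ?mulr0 addr0. Qed.

Fact affine_mulVg : left_inverse affine_one affine_inv affine_mul.
Proof. by move=> [a m]; congr pair; rewrite /= addNr. Qed.

Fact affine_mulgV : right_inverse affine_one affine_inv affine_mul.
Proof.
move=> [a m]; congr pair; rewrite /= ?addrN //.
by rewrite mulrN mulrA -expfzDr // addrN mul1r addrN.
Qed.

HB.instance Definition _ := isGroup.Build affine
  affine_mulA affine_mul1g affine_mulg1 affine_mulVg affine_mulgV.

End AffineGroup.

Definition dyadic : pred affine :=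
  fun g => `[< exists s c : int, g.1 = c%:~R * 2 ^ s >].

Fact dyadic_closed : group_closed dyadic.
Proof.
split; first by apply/asboolP; exists 0, 0; rewrite mul0r.
move=> [a m] [b n] /asboolP[/= s [c ->]] /asboolP[/= t [d ->]].
apply/asboolP => /=.
have -> : (2 : rat) ^ m * - (2 ^ (- n) * (d%:~R * 2 ^ t)) =
    - d%:~R * 2 ^ (m - n + t).
  by rewrite !expfzDr //; ring.
(* Exchanging the two terms only changes the sign of the difference, so the smaller exponent may be
   taken to be [s] and serves as the common one. *)
move: (m - n + t) => {t}t.
wlog st : s t c d / s <= t => [th|].
  have [/th|/ltW ts] := leP s t; first exact.
  have [u [e]] := th t s (- d) (- c) ts.
  by rewrite !rmorphN opprK => ue; exists u, e; rewrite addrC.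
exists s, (c - d * 2 ^+ `|t - s|).
rewrite rmorphB rmorphM rmorphXn /= mulrBl -mulrA; congr (_ + _).
rewrite mulNr; congr (- (_ * _)).
by rewrite exprnP gez0_abs ?subr_ge0 // -expfzDr // subrK.
Qed.

Record bs := BS { bs_val :> affine; _ : dyadic bs_val }.
HB.instance Definition _ := [isSub for bs_val].
HB.instance Definition _ := [Choice of bs by <:].
HB.instance Definition _ := SubChoice_isSubGroup.Build affine dyadic bs
  dyadic_closed.

Lemma bs_val_inj : injective bs_val.
Proof. exact: val_inj. Qed.

Lemma bs_mulE (g h : bs) : bs_val (g * h)%g = (bs_val g * bs_val h)%g.
Proof. by []. Qed.

Lemma bs_dyadic (g : bs) : exists s c : int, (bs_val g).1 = c%:~R * 2 ^ s.
Proof. exact/asboolP/(valP g). Qed.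

Fact dyadic_a : dyadic (1, 0).
Proof. by apply/asboolP; exists 0, 1; rewrite mul1r. Qed.
Fact dyadic_t : dyadic (0, 1).
Proof. by apply/asboolP; exists 0, 0; rewrite mul0r. Qed.

Definition bs_a : bs := BS dyadic_a.
Definition bs_t : bs := BS dyadic_t.

Definition bs_gen (i : 'I_2) : bs := if val i == 0%N then bs_a else bs_t.

Section BSEval.
Variable w : word 2.
Let p := bs_val (eval_word bs_gen w).

Lemma eval_a : bs_val (eval_word bs_gen ((ord0, false) :: w)) = (p.1 + 1, p.2).
Proof.
rewrite eval_word_cons bs_mulE -/p; congr pair; last exact: add0r.
by rewrite mul1r addrC.
Qed.

Lemma eval_aV : bs_val (eval_word bs_gen ((ord0, true) :: w)) = (p.1 - 1, p.2).
Proof.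
rewrite eval_word_cons bs_mulE -/p; congr pair; last by rewrite /= oppr0 add0r.
by rewrite /= oppr0 !mul1r addrC.
Qed.

Lemma eval_t :
  bs_val (eval_word bs_gen ((ord_max, false) :: w)) = (2 * p.1, p.2 + 1).
Proof.
rewrite eval_word_cons bs_mulE -/p; congr pair; last exact: addrC.
by rewrite add0r.
Qed.

Lemma eval_tV :
  bs_val (eval_word bs_gen ((ord_max, true) :: w)) = (2^-1 * p.1, p.2 - 1).
Proof.
rewrite eval_word_cons bs_mulE -/p; congr pair; last exact: addrC.
by rewrite /= mulr0 oppr0 add0r.
Qed.

End BSEval.

(** * Normal forms for the presentation of BS(1,2) *)

Section BSPresentation.
Let a (b : bool) : 'I_2 * bool := (ord0, b).
Let t (b : bool) : 'I_2 * bool := (ord_max, b).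

(** The single relation [t a t^-1 = a^2]. *)
Definition bs_rels : seq (word 2) :=
  [:: [:: t false; a false; t true; a true; a true]].
Notation "v ~~ w" := (presented_eq bs_rels v w) (at level 70).

Let aK w : a false :: a true :: w ~~ w. Proof. exact: presented_consK. Qed.
Let aVK w : a true :: a false :: w ~~ w. Proof. exact: presented_consNK. Qed.
Let tK w : t false :: t true :: w ~~ w. Proof. exact: presented_consK. Qed.
Let tVK w : t true :: t false :: w ~~ w. Proof. exact: presented_consNK. Qed.

(** This rule and the three below move [t] to the right and [t^-1] to the left across [a] or its
    inverse; both moves double the exponent, so no halving is ever needed. *)
Let ta w : t false :: a false :: w ~~ a false :: a false :: t false :: w.
Proof.
have := @presented_relator 2 bs_rels [::]
  (a false :: a false :: t false :: w) _ (mem_head _ _).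
by rewrite /= !aVK tVK.
Qed.

Let taV w : t false :: a true :: w ~~ a true :: a true :: t false :: w.
Proof. by rewrite -[in X in _ ~~ X](aK w) ta !aVK. Qed.

Let atV w : a false :: t true :: w ~~ t true :: a false :: a false :: w.
Proof. by rewrite -[in X in X ~~ _](tVK (a false :: _)) ta tK. Qed.

Let aVtV w : a true :: t true :: w ~~ t true :: a true :: a true :: w.
Proof. by rewrite -[in X in X ~~ _](tVK (a true :: _)) taV tK. Qed.

Definition apow (k : int) : word 2 :=
  match k with Posz n => nseq n (a false) | Negz n => nseq n.+1 (a true) end.

Let a_apow k w : a false :: apow k ++ w ~~ apow (k + 1) ++ w.
Proof.
case: k => n; first by rewrite -PoszD addn1.
case: n => [|n]; first exact: aK.
by rewrite (_ : Negz n.+1 + 1 = Negz n); [exact: aK | lia].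
Qed.

Let aV_apow k w : a true :: apow k ++ w ~~ apow (k - 1) ++ w.
Proof.
case: k => [[|n]|n] //; last by rewrite (_ : Negz n - 1 = Negz n.+1) //; lia.
by rewrite (_ : n.+1%:Z - 1 = n); [exact: aVK | lia].
Qed.

Let t_apow k w : t false :: apow k ++ w ~~ apow (k * 2) ++ t false :: w.
Proof.
elim/int_rect: k => [|n IH|n IH].
- by [].
- rewrite (_ : n.+1%:Z = n%:Z + 1); last by lia.
  rewrite -a_apow ta IH !a_apow.
  by rewrite (_ : n%:Z * 2 + 1 + 1 = (n%:Z + 1) * 2) //; lia.
- rewrite (_ : - n.+1%:Z = - n%:Z - 1); last by lia.
  rewrite -aV_apow taV IH !aV_apow.
  by rewrite (_ : - n%:Z * 2 - 1 - 1 = (- n%:Z - 1) * 2) //; lia.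
Qed.

(** The word [t^-i a^k t^j]. It is not unique for a given element; [normal_lift] accounts for the
    ambiguity. *)
Definition bs_normal (i : nat) (k : int) (j : nat) : word 2 :=
  nseq i (t true) ++ apow k ++ nseq j (t false).

Let a_normal i k j : a false :: bs_normal i k j ~~ bs_normal i (k + 2 ^+ i) j.
Proof.
rewrite /bs_normal; elim: i k => [|i IH] k; first by rewrite a_apow.
rewrite /= atV IH IH exprS (_ : _ + _ = k + 2 * 2 ^+ i) //; ring.
Qed.

Let aV_normal i k j : a true :: bs_normal i k j ~~ bs_normal i (k - 2 ^+ i) j.
Proof.
rewrite /bs_normal; elim: i k => [|i IH] k; first by rewrite aV_apow.
rewrite /= aVtV IH IH exprS (_ : _ - _ = k - 2 * 2 ^+ i) //; ring.
Qed.

(** Normal forms are stable under prefixing a letter: [a] crosses [t^-i] and becomes [a^(2^i)],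
    while [t] cancels against [t^-i] or, if [i = 0], crosses [a^k]. *)
Let normalP w : exists i k j, w ~~ bs_normal i k j.
Proof.
elim: w => [|[l b] w [i [k [j wE]]]]; first by exists 0%N, 0, 0%N.
have [->|->] : l = ord0 \/ l = ord_max.
  by case: l => [[|[|//]] lt]; [left | right]; apply: val_inj.
- case: b; [exists i, (k - 2 ^+ i), j | exists i, (k + 2 ^+ i), j]; rewrite wE.
    exact: aV_normal.
  exact: a_normal.
- case: b; first by exists i.+1, k, j; rewrite wE.
  case: i wE => [|i] wE; [exists 0%N, (k * 2), j.+1 | exists i, k, j].
    by rewrite wE; exact: t_apow.
  by rewrite wE; exact: tK.
Qed.

Let normal_lift i k j : bs_normal i.+1 (k * 2) j.+1 ~~ bs_normal i k j.
Proof.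
have -> : bs_normal i.+1 (k * 2) j.+1 =
    nseq i (t true) ++ t true :: apow (k * 2) ++ t false :: nseq j (t false).
  by rewrite /bs_normal -cat_rcons -cats1 -(nseqD i 1) addn1.
by rewrite -t_apow tVK.
Qed.

Let normal_liftn i k j d : bs_normal (i + d) (k * 2 ^+ d) (j + d) ~~ bs_normal i k j.
Proof.
elim: d => [|d IH]; first by rewrite !addn0 mulr1.
by rewrite exprSr mulrA !addnS normal_lift.
Qed.

Lemma eval_apow k : bs_val (eval_word bs_gen (apow k)) = (k%:~R, 0).
Proof.
case: k => n.
  elim: n => [|n IH]; first by rewrite /eval_word big_nil.
  by rewrite eval_a IH -[in RHS]addn1 PoszD rmorphD.
have -> : apow (Negz n) = nseq n.+1 (a true) by [].
rewrite NegzE; elim: n.+1 => [|m IH].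
  by rewrite /eval_word big_nil.
by rewrite eval_aV IH -[in RHS]addn1 PoszD opprD rmorphB.
Qed.

Lemma eval_bs_normal i k j :
  bs_val (eval_word bs_gen (bs_normal i k j)) =
  (k%:~R * 2 ^ (- i%:Z), j%:Z - i%:Z).
Proof.
elim: i => [|i IH].
  rewrite (_ : bs_normal 0 k j = apow k ++ nseq j (t false)) //.
  rewrite eval_word_cat bs_mulE eval_apow oppr0 mulr1.
  suff -> : bs_val (eval_word bs_gen (nseq j (t false))) = (0, j%:Z).
    by congr pair => /=; rewrite ?mulr0 ?addr0 ?add0r ?subr0.
  elim: j => [|j IH]; first by rewrite /eval_word big_nil.
  by rewrite eval_t IH mulr0 -addn1 PoszD.
rewrite eval_tV IH; congr pair => /=; last by lia.
by rewrite mulrCA -[2^-1]/(2 ^ (-1)) -expfzDr //; congr (_ * 2 ^ _); lia.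
Qed.

Lemma bs_gen_surjective (g : bs) : exists w, eval_word bs_gen w = g.
Proof.
have [s [c gE]] := bs_dyadic g.
(* Large enough that [c * 2 ^ s] has denominator dividing [2 ^ i] and that the final exponent
   [m + i] of [t] is nonnegative, [m] being the second component. *)
pose i := (`|s| + `|(bs_val g).2|)%N.
exists (bs_normal i (c * 2 ^+ `|s + i%:Z|) `|(bs_val g).2 + i%:Z|).
apply: bs_val_inj.
rewrite eval_bs_normal [RHS]surjective_pairing gE; congr pair; last by lia.
rewrite rmorphM rmorphXn /= -mulrA exprnP -expfzDr //; congr (_ * 2 ^ _); lia.
Qed.

Lemma bs_finitely_presented : finitely_presented bs.
Proof.
exists 2%N, bs_rels, bs_gen; split; first exact: bs_gen_surjective.
have rel1 r : r \in bs_rels -> eval_word bs_gen r = 1%g.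
  rewrite inE => /eqP ->; apply: bs_val_inj.
  rewrite eval_t eval_a eval_tV !eval_aV /eval_word big_nil /=.
  by congr pair => /=; lra.
move=> v w; split=> [vw|]; last exact: presented_eq_eval.
have [[i [k [j vE]]] [i' [k' [j' wE]]]] := (normalP v, normalP w).
have := vw; rewrite (presented_eq_eval rel1 vE) (presented_eq_eval rel1 wE).
move=> /(congr1 bs_val); rewrite !eval_bs_normal vE wE => {vw vE wE}.
(* Two normal forms with the same value remain; the one with the larger [i] is shown to be an
   iterated lift of the other. *)
wlog ii : i k j i' k' j' / (i <= i')%N => [th [e f]|].
  case: (leqP i i') => [/th|/ltnW /th]; first by apply; congr pair.
  by move=> sym; apply/presented_sym/sym; congr pair.
rewrite -(subnKC ii); move: (i' - i)%N => d {i' ii} [ke je].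
have -> : j' = (j + d)%N by lia.
suff -> : k' = k * 2 ^+ d by apply: presented_sym; exact: normal_liftn.
apply: (@intr_inj rat); rewrite rmorphM rmorphXn /= exprnP.
apply: (mulIf (_ : 2 ^ (- (i + d)%:Z) != 0 :> rat)); first by rewrite expfz_neq0.
rewrite -ke -mulrA -expfzDr //; congr (_ * 2 ^ _); lia.
Qed.

End BSPresentation.

(** * Word length *)

Definition letter n (G : groupType) (x : 'I_n -> G) (l : 'I_n * bool) : G :=
  if l.2 then (x l.1)^-1%g else x l.1.

Lemma eval_wordE n (G : groupType) (x : 'I_n -> G) w :
  eval_word x w = (\prod_(s <- map (letter x) w) s)%g.
Proof. by rewrite big_map. Qed.

Lemma letters_finite_symmetric_generating n (G : groupType) (x : 'I_n -> G) :
  (forall g, exists w, eval_word x w = g) ->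
  finite_symmetric_generating (range (letter x)).
Proof.
move=> surj; split.
- by apply: finite_image; exact: finite_finset.
- move=> _ [[i b] _ <-]; exists (i, ~~ b) => //.
  by case: b; rewrite /letter //= invgK.
- apply/seteqP; split=> // g _ H [[H1 HM HV] SH]; have [w <-] := surj g.
  elim: w => [|l w IH]; first by rewrite /eval_word big_nil.
  by rewrite eval_word_cons; apply: HM => //; apply: SH; exists l.
Qed.

Section WordLengthLetters.
Variables (R : realType) (n : nat) (G : groupType) (x : 'I_n -> G).
Local Open Scope ereal_scope.

Lemma word_length_eval w :
  word_length R (range (letter x)) (eval_word x w) <= (size w)%:R%:E.
Proof.
apply: ereal_inf_lbound => /=; exists (map (letter x) w); last first.
  by rewrite size_map.
by split; [move=> s /mapP[l _ ->]; exists l | rewrite eval_wordE].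
Qed.

Lemma word_length_ge (y : \bar R) g :
  (forall w, eval_word x w = g -> y <= (size w)%:R%:E) ->
  y <= word_length R (range (letter x)) g.
Proof.
move=> yP; apply: le_ereal_inf_tmp => _ [s [sS sg] <-].
have [w sE] : exists w, s = map (letter x) w.
  elim: s sS {sg} => [|u s IH] sS; first by exists [::].
  have [w ->] := IH (fun v vs => sS v (mem_behead (s := u :: s) vs)).
  by have [l _ <-] := sS u (mem_head _ _); exists (l :: w).
by rewrite sE size_map; apply: yP; rewrite eval_wordE -sE.
Qed.

End WordLengthLetters.

(** * Short words in the lamplighter group *)

Definition lamp_gen (i : 'I_2) : lamp :=
  if val i == 0%N then ([fset 0]%fset, 0) else (fset0, 1).

Section LampWords.
Let a : 'I_2 * bool := (ord0, false).
Let t (b : bool) : 'I_2 * bool := (ord_max, b).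

Lemma eval_lamp_a w : eval_word lamp_gen (a :: w) =
  (symdiff [fset 0]%fset (eval_word lamp_gen w).1, (eval_word lamp_gen w).2).
Proof.
rewrite eval_word_cons; congr pair; last exact: add0r.
by apply/fsetP => i; rewrite !in_lamps subr0.
Qed.

Lemma eval_lamp_t w : eval_word lamp_gen (t false :: w) =
  (translate 1 (eval_word lamp_gen w).1, (eval_word lamp_gen w).2 + 1).
Proof.
rewrite eval_word_cons; congr pair; last exact: addrC.
by apply/fsetP => i; rewrite !in_lamps.
Qed.

Lemma eval_lamp_tV w : eval_word lamp_gen (t true :: w) =
  (translate (-1) (eval_word lamp_gen w).1, (eval_word lamp_gen w).2 - 1).
Proof.
rewrite eval_word_cons; congr pair; last exact: addrC.
by apply/fsetP => i; rewrite !in_lamps.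
Qed.

Definition tpow (k : int) : word 2 := nseq `|k| (t (k < 0)).

Lemma eval_tpow k : eval_word lamp_gen (tpow k) = (fset0, k).
Proof.
rewrite /tpow; case: (ltP k 0) => k0.
  rewrite [k in RHS](_ : k = - `|k|%:Z); last by lia.
  move: `|k|%N => n {k k0}; elim: n => [|n IH]; first by rewrite /eval_word big_nil.
  rewrite eval_lamp_tV IH; congr pair => /=; last by lia.
  by apply/fsetP => i; rewrite !in_lamps.
rewrite [k in RHS](_ : k = `|k|%:Z); last by lia.
move: `|k|%N => n {k k0}; elim: n => [|n IH]; first by rewrite /eval_word big_nil.
rewrite eval_lamp_t IH; congr pair => /=; last by lia.
by apply/fsetP => i; rewrite !in_lamps.
Qed.

(** Walk right across the window and switch each lamp of [A] when passing it: at most two letters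
    per position. *)
Lemma lamp_sweep (A : {fset int}) (r : nat) :
  (forall i, i \in A -> 0 <= i < r%:Z) ->
  exists2 w, eval_word lamp_gen w = (A, r%:Z) & (size w <= 2 * r)%N.
Proof.
elim: r A => [|r IH] A Ar.
  exists [::] => //; rewrite /eval_word big_nil; congr pair.
  by apply/fsetP => i; rewrite inE; apply/esym/negP => /Ar; lia.
have [|w wE ws] := IH (translate (-1) (A `\ 0)%fset).
  by move=> i; rewrite !in_lamps => /andP[i0 /Ar]; lia.
have [A0|A0] := boolP (0 \in A).
- exists (a :: t false :: w); last by rewrite /=; lia.
  rewrite eval_lamp_a eval_lamp_t wE; congr pair => /=; last by lia.
  apply/fsetP => i; rewrite !in_lamps opprK subrK.
  by have [->|] := eqVneq i 0.
- exists (t false :: w); last by rewrite /=; lia.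
  rewrite eval_lamp_t wE; congr pair => /=; last by lia.
  apply/fsetP => i; rewrite !in_lamps opprK subrK.
  by have [->|] := eqVneq i 0; rewrite ?(negPf A0).
Qed.

(** Walk to the left end [l], sweep the window, then walk from [l + r] to [m]. *)
Lemma lamp_word_window (A : {fset int}) (m l : int) (r : nat) :
  (forall i, i \in A -> l <= i < l + r%:Z) ->
  exists2 w, eval_word lamp_gen w = (A, m) &
    (size w <= `|l| + 2 * r + `|(m - l - r%:Z)%R|)%N.
Proof.
move=> Alr; have [|w wE ws] := @lamp_sweep (translate (- l) A) r.
  by move=> i; rewrite !in_lamps => /Alr; lia.
exists (tpow l ++ w ++ tpow (m - l - r%:Z)); last first.
  by rewrite !size_cat !size_nseq; lia.
rewrite !eval_word_cat !eval_tpow wE; congr pair => /=; last by lia.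
by apply/fsetP => i; rewrite !in_lamps opprK subrK addbF.
Qed.

Lemma lamp_gen_surjective g : exists w, eval_word lamp_gen w = g.
Proof.
case: g => A m; pose K := (\sum_(i <- A) `|i|)%N.
have [|w wE _] := @lamp_word_window A m (- K%:Z) (2 * K).+1; last by exists w.
move=> i iA; have : (`|i| <= K)%N by rewrite /K (big_fsetD1 i) //= leq_addr.
lia.
Qed.

End LampWords.

(** * Two-sided coin tossing *)

(** The parameter [R] fixes the reals in which the metric on this space takes its values. *)
Definition conf (R : realType) : Type := int -> bool.
HB.instance Definition _ R := Choice.on (conf R).
HB.instance Definition _ R := isPointed.Build (conf R) (fun=> false).

Definition agree (s : int) (l : nat) (x y : int -> bool) : Prop :=
  forall k : nat, (k < l)%N -> x (s + k%:Z) = y (s + k%:Z).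

Lemma agree_sym s l x y : agree s l x y -> agree s l y x.
Proof. by move=> xy k /xy. Qed.

Lemma agree_trans s l y x z : agree s l x y -> agree s l y z -> agree s l x z.
Proof. by move=> xy yz k kl; rewrite xy // yz. Qed.

Lemma agree_sub (s s' : int) (l l' : nat) x y : s' <= s -> s + l%:Z <= s' + l'%:Z ->
  agree s' l' x y -> agree s l x y.
Proof.
move=> ss ll xy k kl; have := xy `|(s + k%:Z - s')%R|%N.
by rewrite (_ : s' + _ = s + k%:Z); [apply; lia | lia].
Qed.

Definition balanced (n : nat) := agree (- n%:Z) (2 * n).

Lemma balancedP n x y :
  balanced n x y <-> forall i, - n%:Z <= i < n%:Z -> x i = y i.
Proof.
split=> [xy i ni|xy k kl]; last by apply: xy; lia.
have := xy `|(i + n%:Z)%R|%N.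
by rewrite (_ : - n%:Z + _ = i); [apply; lia | lia].
Qed.

Lemma balanced_le m n x y : (m <= n)%N -> balanced n x y -> balanced m x y.
Proof. by move=> mn; apply: agree_sub; lia. Qed.

(** * The complete separable ultrametric on two-sided sequences *)

Section ConfMetric.
Variable R : realType.
Implicit Types x y z : conf R.

(** The value is [2 ^- n] for the least [n] such that [x] and [y] differ somewhere on [[-n, n)].
    Balls of radius [2 ^- n] are then exactly the balanced cylinders. *)
Definition conf_dist x y : R :=
  if pselect (exists n, ~~ `[< balanced n x y >]) is left e
  then 2 ^- ex_minn e else 0.

Lemma conf_dist_lt x y n : (conf_dist x y < 2 ^- n) <-> balanced n x y.
Proof.
rewrite /conf_dist; case: pselect => [e|e]; last first.
  rewrite invr_gt0 exprn_gt0 //; split=> // _.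
  by apply: contrapT => nxy; apply: e; exists n; apply/asboolPn.
case: ex_minnP => k /asboolPn nk kmin; rewrite ltf_pV2 ?posrE ?exprn_gt0 //.
rewrite ltr_eXn2l // ?ltr1n //; split=> [nk'|xy].
  by apply: contrapT => /asboolPn /kmin; rewrite leqNgt nk'.
by rewrite ltnNge; apply/negP => kn; apply: nk; exact: balanced_le kn xy.
Qed.

Lemma conf_dist_ge0 x y : 0 <= conf_dist x y.
Proof. by rewrite /conf_dist; case: pselect => // e; rewrite invr_ge0 exprn_ge0. Qed.

Lemma conf_dist_cases x y :
  conf_dist x y = 0 \/ exists2 n, conf_dist x y = 2 ^- n & ~ balanced n x y.
Proof.
rewrite /conf_dist; case: pselect => [e|e]; [right | by left].
by case: ex_minnP => k /asboolPn nk _; exists k.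
Qed.

Fact conf_distxx x : conf_dist x x = 0.
Proof. by have [//|[n _ []]] := conf_dist_cases x x. Qed.

Fact conf_dist_positivity x y : conf_dist x y = 0 -> x = y.
Proof.
move=> xy0; apply/funext => i.
have /balancedP : balanced `|i|.+1 x y.
  by apply/conf_dist_lt; rewrite xy0 invr_gt0 exprn_gt0.
by apply; lia.
Qed.

Fact conf_dist_sym x y : conf_dist x y = conf_dist y x.
Proof.
have le u v : conf_dist u v <= conf_dist v u.
  have [->|[n -> nuv]] := conf_dist_cases u v; first exact: conf_dist_ge0.
  by rewrite leNgt; apply/negP => /conf_dist_lt /agree_sym.
by apply/eqP; rewrite eq_le !le.
Qed.

Fact conf_dist_triangle y x z : conf_dist x z <= conf_dist x y + conf_dist y z.
Proof.
have [->|[n -> nxz]] := conf_dist_cases x z.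
  by rewrite addr_ge0 ?conf_dist_ge0.
rewrite leNgt; apply/negP => xyz; apply: nxz; apply: (@agree_trans _ _ y);
  apply/conf_dist_lt; apply: le_lt_trans xyz; rewrite ?lerDl ?lerDr conf_dist_ge0 //.
Qed.

HB.instance Definition _ := isMetric.Build R (conf R)
  conf_distxx conf_dist_positivity conf_dist_sym conf_dist_triangle.

Lemma conf_ball x n : ball x (2 ^- n) = [set y | balanced n x y].
Proof.
by rewrite ballEmdist; apply/seteqP; split=> y /= /conf_dist_lt.
Qed.

Lemma conf_nbhsP x (A : set (conf R)) :
  nbhs x A <-> exists n, [set y | balanced n x y] `<=` A.
Proof.
split=> [/nbhs_ballP[e e0 eA]|[n nA]]; last first.
  apply/nbhs_ballP; exists (2 ^- n); first by rewrite /= invr_gt0 exprn_gt0.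
  by rewrite conf_ball.
have [n ne] : exists n, (2 : R) ^- n < e.
  have [n _ /(_ n (leqnn _))] := near_infty_natSinv_expn_lt (PosNum e0).
  by rewrite div1r; exists n.
exists n; apply: subset_trans eA => y nxy; apply: le_ball (ltW ne) _ _.
by rewrite conf_ball.
Qed.

Definition cylinder s l (p : int -> bool) : set (conf R) := [set x | agree s l p x].

Lemma cylinder_balanced s l : exists n, forall x y, balanced n x y -> agree s l x y.
Proof.
exists (`|s| + l)%N => x y; apply: agree_sub; lia.
Qed.

Lemma open_cylinder s l p : open (cylinder s l p).
Proof.
rewrite openE => x px; apply/conf_nbhsP.
have [n nP] := cylinder_balanced s l; exists n => y /nP.
exact: agree_trans.
Qed.

Definition fset_conf (A : {fset int}) : conf R := fun i => i \in A.

Lemma fset_conf_balanced n x : exists A, balanced n (fset_conf A) x.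
Proof.
pose e (k : nat) : int := - n%:Z + k%:Z.
exists [fset i in [seq e k | k <- iota 0 (2 * n) & x (e k)]]%fset => k kn.
rewrite /fset_conf inE /= -/(e k).
apply/mapP/idP => [[j]|xk]; last by exists k; rewrite // mem_filter xk mem_iota.
by rewrite mem_filter => /andP[xj _] /addrI [->].
Qed.

Lemma conf_separable : exists2 D : set (conf R), countable D & dense D.
Proof.
exists (range fset_conf).
  by apply: card_le_trans (card_image_le _ _) _; exact: countableP.
move=> U [x Ux] oU.
have /conf_nbhsP[n nU] : nbhs x U by exact: open_nbhs_nbhs.
have [A Ax] := fset_conf_balanced n x.
by exists (fset_conf A); split; [apply: nU; exact: agree_sym | exists A].
Qed.

Lemma conf_complete (F : set_system (conf R)) :
  ProperFilter F -> cauchy F -> exists l : conf R, F --> l.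
Proof.
move=> PF /cauchyP Fc.
have /choice[u uF] n : exists x, F [set y | balanced n x y].
  have [x] := Fc (2 ^- n) ltac:(by rewrite invr_gt0 exprn_gt0).
  by rewrite conf_ball; exists x.
(* The limit is diagonal: its coordinate [i] is read off a centre [u] whose window [[-|i|-1, |i|+1)]
   contains [i]. *)
exists (fun i => u `|i|.+1 i : bool) => A /conf_nbhsP[n nA].
apply: filterS (uF n) => y uy; apply: nA; apply/balancedP => i ni.
have [z [/= zu zi]] := filter_ex (filterI (uF n) (uF `|i|.+1)).
move: uy zu zi => /= /balancedP uy /balancedP zu /balancedP zi.
by rewrite -uy // zu // zi //; lia.
Qed.

End ConfMetric.

(** * The Borel sigma-algebra and its generation by cylinders *)

Section CoinSpace.
Variable R : realType.

Definition coin_space := g_sigma_algebraType (@open (conf R)).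
HB.instance Definition _ := Measurable.on coin_space.

(** Restricting to windows with [n >= n0] keeps a generating pi-system, and allows conditions to be
    checked on large windows only, as the action of BS(1,2) demands. *)
Definition cylinder_class (n0 : nat) : set (set coin_space) :=
  [set A | [\/ A = set0, A = setT |
    exists n p, (n0 <= n)%N /\ A = [set x | balanced n p x]]].

Lemma measurable_cylinder s l p : measurable (cylinder s l p : set coin_space).
Proof. by apply: sub_sigma_algebra; exact: open_cylinder. Qed.

Lemma cylinder_class_setI n0 : setI_closed (cylinder_class n0).
Proof.
move=> A B [->|->|[m [p [m0 ->]]]]; first by rewrite set0I; by constructor 1.
  by rewrite setTI.
move=> [->|->|[n [q [n0' ->]]]]; first by rewrite setI0; by constructor 1.
  by rewrite setIT; constructor 3; exists m, p.
wlog mn : m n p q m0 n0' / (m <= n)%N => [th|].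
  by case: (leqP m n) => [/th|/ltnW /th]; [|rewrite setIC]; apply.
have [pq|pq] := pselect (balanced m p q).
  constructor 3; exists n, q; split=> //; apply/seteqP; split=> [x []//|x qx].
  by split=> //=; apply: (agree_trans pq); exact: balanced_le mn qx.
constructor 1; apply/seteqP; split=> // x [/= px qx]; apply: pq.
by apply: agree_trans px (agree_sym _); exact: balanced_le mn qx.
Qed.

Lemma cylinder_class_generates n0 :
  @measurable _ coin_space = <<s cylinder_class n0 >>.
Proof.
apply/seteqP; split; apply: smallest_sub.
- exact: smallest_sigma_algebra.
- move=> U oU; pose T := g_sigma_algebraType (cylinder_class n0).
  (* An open set is the union of the balanced cylinders it contains whose centres have finite
     support: a countable union. *)
  rewrite [U](_ : _ = \bigcup_(An in [set An : {fset int} * nat |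
      [set y | balanced (n0 + An.2) (fset_conf R An.1) y] `<=` U])
      [set y | balanced (n0 + An.2) (fset_conf R An.1) y]).
    rewrite bigcup_mkcond; apply: (@countable_bigcupT_measurable _ T).
      exact: countableP.
    move=> An; case: ifP => _; last exact: measurable0.
    apply: sub_sigma_algebra; constructor 3.
    by exists (n0 + An.2)%N, (fset_conf R An.1); rewrite leq_addr.
  apply/seteqP; split=> [x Ux|x [An /= +]]; last exact.
  have /conf_nbhsP[n nU] : nbhs (x : conf R) U by exact: open_nbhs_nbhs.
  have [A Ax] := @fset_conf_balanced R (n0 + n) x.
  exists (A, n) => //= y Ay; apply: nU.
  apply: (@balanced_le n (n0 + n)); first exact: leq_addl.
  by apply: agree_trans Ay; exact: agree_sym.
- exact: sigma_algebra_measurable.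
- move=> _ [->|->|[n [p [_ ->]]]]; [exact: measurable0|exact: measurableT|].
  exact: measurable_cylinder.
Qed.

Lemma coin_measure_unique n0 (m1 m2 : {measure set coin_space -> \bar R}) :
  (m1 setT < +oo)%E -> m1 setT = m2 setT ->
  (forall n p, (n0 <= n)%N ->
    m1 [set x | balanced n p x] = m2 [set x | balanced n p x]) ->
  forall A, measurable A -> m1 A = m2 A.
Proof.
move=> fin1 eqT eqc A mA.
apply: (measure_unique (cylinder_class n0) (fun=> setT)) => //.
- exact: cylinder_class_generates.
- exact: cylinder_class_setI.
- by move=> _; by constructor 2.
- by rewrite bigcup_const.
- by move=> _ [->|->|[n [p [nn ->]]]]; rewrite ?measure0 // eqc.
Qed.

Lemma measurable_to_coin_space d (T : measurableType d) (f : T -> coin_space) n0 :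
  (forall n p, (n0 <= n)%N -> measurable (f @^-1` [set x | balanced n p x])) ->
  measurable_fun setT f.
Proof.
move=> mf; apply: (measurability (cylinder_class n0)).
  exact: cylinder_class_generates.
move=> _ [_ [->|->|[n [p [nn ->]]]] <-]; rewrite setTI.
- by rewrite preimage_set0.
- by rewrite preimage_setT.
- exact: mf.
Qed.

End CoinSpace.

(** * The fair coin measure, transported from Lebesgue measure on [0, 1) *)

Section CoinMeasure.
Variable R : realType.

Definition digit (r : R) (k : nat) : bool := odd `|Num.floor (2 ^+ k.+1 * r)|.

(** The integer with binary digits [b 0, ..., b (k - 1)], most significant first; divided by [2 ^ k]
    it is the left end of the dyadic interval with these digits. *)
Fixpoint prefix_value (b : nat -> bool) (k : nat) : nat :=
  if k is k'.+1 then (b k' + 2 * prefix_value b k')%N else 0%N.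

Definition dyadic_interval (v k : nat) : set R :=
  `[v%:R / 2 ^+ k, v.+1%:R / 2 ^+ k[%classic.

Lemma dyadic_intervalP v k r :
  dyadic_interval v k r <-> v%:R <= 2 ^+ k * r < v.+1%:R.
Proof.
have k0 : 0 < (2 : R) ^+ k by rewrite exprn_gt0.
by rewrite /dyadic_interval /= in_itv /= ler_pdivrMr // ltr_pdivlMr // mulrC.
Qed.

Lemma digit_dyadic_interval v k r : dyadic_interval v k r ->
  dyadic_interval (digit r k + 2 * v) k.+1 r.
Proof.
move=> /dyadic_intervalP vr; apply/dyadic_intervalP; move: vr.
have e0 : (2 * v)%:R = 2 * v%:R :> R by rewrite natrM.
have e1 : (2 * v).+1%:R = 2 * v%:R + 1 :> R by rewrite -e0 natr1.
have e2 : (2 * v).+2%:R = 2 * v%:R + 2 :> R by rewrite -e0 -natrD addn2.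
rewrite /digit exprS -mulrA -natr1; move: (2 ^+ k * r) => X /andP[vX Xv].
have [lt|le] := ltP (2 * X) (2 * v%:R + 1).
- rewrite (@floor_def _ _ (2 * v)%N%:Z); last first.
    by rewrite intrD -!pmulrn e0; apply/andP; split; lra.
  by rewrite absz_nat oddM /= add0n e0 e1; apply/andP; split; lra.
- rewrite (@floor_def _ _ (2 * v).+1%:Z); last first.
    by rewrite intrD -!pmulrn e1; apply/andP; split; lra.
  by rewrite absz_nat /= oddM /= add1n e1 e2; apply/andP; split; lra.
Qed.

Lemma dyadic_interval_half b v k :
  dyadic_interval (nat_of_bool b + 2 * v) k.+1 `<=` dyadic_interval v k.
Proof.
move=> r /dyadic_intervalP; rewrite exprS -mulrA => bvr.
apply/dyadic_intervalP; move: bvr; move: (2 ^+ k * r) => X.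
rewrite -![_.+1%:R]natr1 natrD natrM => /andP[].
by case: b => /= le1 lt1; apply/andP; split; lra.
Qed.

Lemma dyadic_interval_disjoint v w k r :
  dyadic_interval v k r -> dyadic_interval w k r -> v = w.
Proof.
move=> /dyadic_intervalP/andP[a b] /dyadic_intervalP/andP[c d].
have := le_lt_trans a d; have := le_lt_trans c b.
by rewrite !ltr_nat; lia.
Qed.

Lemma digits_dyadic_interval (b : nat -> bool) k :
  [set r : R | (forall j, (j < k)%N -> digit r j = b j) /\ 0 <= r < 1] =
  dyadic_interval (prefix_value b k) k.
Proof.
elim: k => [|k IH].
  apply/seteqP; split=> r.
    by move=> [_ r01]; apply/dyadic_intervalP; rewrite mul1r.
  by move/dyadic_intervalP; rewrite mul1r.
apply/seteqP; split=> r.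
  move=> [rb r01]; have : dyadic_interval (prefix_value b k) k r.
    by rewrite -IH; split=> // j jk; apply: rb; exact: ltnW.
  by move/digit_dyadic_interval; rewrite rb.
move=> rI; have rI' := dyadic_interval_half rI.
have rk : digit r k = b k.
  have /addIn := dyadic_interval_disjoint (digit_dyadic_interval rI') rI.
  by case: (digit r k) (b k) => [] [].
move: rI'; rewrite -IH => -[rb r01]; split=> // j.
by rewrite ltnS leq_eqVlt => /orP[/eqP ->//|]; exact: rb.
Qed.

Lemma measurable_digit k b : measurable [set r : R | digit r k = b].
Proof.
have -> : [set r : R | digit r k = b] = \bigcup_(z in [set z : int | odd `|z| = b])
    `[z%:~R / 2 ^+ k.+1, (z + 1)%:~R / 2 ^+ k.+1[%classic.
  have k0 : 0 < (2 : R) ^+ k.+1 by rewrite exprn_gt0.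
  apply/seteqP; split=> [r rb|r [z zb]].
    exists (Num.floor (2 ^+ k.+1 * r)) => //=.
    by rewrite in_itv /= ler_pdivrMr // ltr_pdivlMr // mulrC floor_itv.
  rewrite /= in_itv /= ler_pdivrMr // ltr_pdivlMr // mulrC => /floor_def.
  by rewrite /digit => ->.
rewrite bigcup_mkcond; apply: countable_bigcupT_measurable; first exact: countableP.
by move=> z; case: ifP => _; [exact: measurable_itv | exact: measurable0].
Qed.

(* Two-sided sequences are the binary digits of a uniform real number, reindexed
   so that the first [2 * n] digits fill the window [-n, n). *)
Definition digit_index (i : int) : nat :=
  match i with Posz n => (2 * n)%N | Negz n => (2 * n).+1 end.
Definition index_digit (k : nat) : int := if odd k then Negz k./2 else Posz k./2.

Lemma index_digitK : cancel index_digit digit_index.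
Proof. by move=> k; rewrite /index_digit; case: ifP => ok /=; lia. Qed.

Lemma digit_index_lt n i : (- n%:Z <= i < n%:Z) = (digit_index i < 2 * n)%N.
Proof. by case: i => k /=; apply/idP/idP; lia. Qed.

Lemma index_digit_lt n k : (k < 2 * n)%N -> - n%:Z <= index_digit k < n%:Z.
Proof. by rewrite digit_index_lt index_digitK. Qed.

Definition digits (r : measurableTypeR R) : coin_space R :=
  fun i => digit r (digit_index i).

Lemma digits_balanced n p r : balanced n p (digits r) <->
  forall j, (j < 2 * n)%N -> digit r j = p (index_digit j).
Proof.
split=> [/balancedP pr j jn|pr].
  by rewrite pr ?index_digit_lt // /digits index_digitK.
apply/balancedP => i; rewrite digit_index_lt => /pr; rewrite /digits => ->.
by congr p; case: i => k; rewrite /index_digit /=; case: ifP => ok; lia.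
Qed.

Fact measurable_digits : measurable_fun setT digits.
Proof.
(* Taking [n > 0] makes the intersection over the digits below have a nonempty index set. *)
apply: (@measurable_to_coin_space _ _ _ _ 1%N) => n p n0.
have -> : digits @^-1` [set x | balanced n p x] =
    \bigcap_(j in [set j | (j < 2 * n)%N]) [set r | digit r j = p (index_digit j)].
  by apply/seteqP; split=> r /= /digits_balanced.
apply: bigcap_measurable => [|j _]; last exact: measurable_digit.
by exists 0%N; rewrite /= muln_gt0.
Qed.

HB.instance Definition _ :=
  @isMeasurableFun.Build _ _ (measurableTypeR R) _ digits measurable_digits.

Definition unit_interval : set (measurableTypeR R) -> \bar R :=
  mrestr lebesgue_measure (measurable_itv `[(0 : R), 1[).

HB.instance Definition _ := Measure.on unit_interval.

Fact unit_interval_setT : unit_interval setT = 1%E.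
Proof.
rewrite /unit_interval /mrestr setTI lebesgue_measure_itv /= lte_fin ltr01.
by rewrite sube0.
Qed.

HB.instance Definition _ :=
  Measure_isProbability.Build _ _ _ unit_interval unit_interval_setT.

Definition coin : probability (coin_space R) R := distribution unit_interval digits.

Lemma coin_balanced n p : coin [set x | balanced n p x] = (2 ^- (2 * n))%:E.
Proof.
rewrite /coin /= /distribution /pushforward /unit_interval /mrestr.
have -> : digits @^-1` [set x | balanced n p x] `&` `[0, 1[%classic =
    dyadic_interval (prefix_value (p \o index_digit) (2 * n)) (2 * n).
  rewrite -digits_dyadic_interval; apply/seteqP; split=> r /=.
    by move=> [/digits_balanced pr]; rewrite in_itv.
  move=> [pr r01]; rewrite in_itv; split=> //.
  exact/digits_balanced.
have k0 : 0 < (2 : R) ^+ (2 * n) by rewrite exprn_gt0.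
rewrite lebesgue_measure_itv /= lte_fin ltr_pM2r ?invr_gt0 // ltr_nat ltnSn.
by rewrite -EFinD -mulrBl -natr1 addrAC subrr add0r mul1r.
Qed.

End CoinMeasure.

(** * Measure preservation and the lamplighter action *)

Section CoinPreserving.
Variable R : realType.
Notation mu := (coin R).
Implicit Types (x p q : coin_space R) (f : coin_space R -> coin_space R).

Lemma measurable_of_cylinders f n0 :
  (forall n p, (n0 <= n)%N -> exists s l q,
    f @^-1` [set x | balanced n p x] = cylinder s l q) ->
  measurable_fun setT f.
Proof.
move=> fP; apply: (@measurable_to_coin_space _ _ _ _ n0) => n p /fP - /(_ p).
by move=> [s [l [q ->]]]; exact: measurable_cylinder.
Qed.

Let preserving_of_measures f n0 : measurable_fun setT f ->
  (forall n p, (n0 <= n)%N ->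
    mu (f @^-1` [set x | balanced n p x]) = mu [set x | balanced n p x]) ->
  forall A, measurable A -> mu (f @^-1` A) = mu A.
Proof.
move=> mf fP A mA; pose g := mfun_Sub (mem_set mf : f \in mfun).
apply: (@coin_measure_unique _ n0 (distribution mu g) mu) => //.
exact: le_lt_trans (probability_le1 _ measurableT) (ltry 1).
Qed.

Lemma measurable_coord (j : int) b : measurable [set x : coin_space R | x j = b].
Proof.
rewrite [X in measurable X](_ : _ = cylinder j 1 (fun=> b)).
  exact: measurable_cylinder.
apply/seteqP; split=> x /=.
  by move=> xb [|//] _; rewrite addr0.
by move=> /(_ 0%N isT); rewrite addr0.
Qed.

Definition lamp_act (g : lamp) (x : coin_space R) : coin_space R :=
  fun i => (i \in g.1) (+) x (i - g.2).

Lemma lamp_act1 x : lamp_act 1%g x = x.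
Proof. by apply/funext => i; rewrite /lamp_act inE subr0. Qed.

Lemma lamp_actM g h x : lamp_act (g * h)%g x = lamp_act g (lamp_act h x).
Proof.
by apply/funext => i; rewrite /lamp_act !in_lamps -addbA opprD addrA.
Qed.

Definition lit (A : {fset int}) : lamp := (A, 0).

Lemma agree_lamp g s l p x :
  agree s l p (lamp_act g x) <-> agree (s - g.2) l (lamp_act g^-1%g p) x.
Proof.
suff E k : (p (s + k%:Z) = lamp_act g x (s + k%:Z)) <->
    (lamp_act g^-1%g p (s - g.2 + k%:Z) = x (s - g.2 + k%:Z)).
  by split=> px k kl; apply/E; exact: px.
have -> : s - g.2 + k%:Z = s + k%:Z - g.2 by rewrite addrAC.
rewrite /lamp_act /= in_translate opprK subrK.
by split=> [->|<-]; rewrite addKb.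
Qed.

Lemma lamp_preimage_cylinder g s l p :
  lamp_act g @^-1` cylinder s l p = cylinder (s - g.2) l (lamp_act g^-1%g p).
Proof. by apply/seteqP; split=> x /agree_lamp. Qed.

Lemma measurable_lamp_act g : measurable_fun setT (lamp_act g).
Proof.
apply: (@measurable_of_cylinders _ 0%N) => n p _.
exists (- n%:Z - g.2), (2 * n)%N, (lamp_act g^-1%g p).
exact: lamp_preimage_cylinder.
Qed.

(** Without a shift, balanced windows pull back to balanced windows, whose measure is already known.
    Windows in other positions are measured only afterwards, by means of this lemma. *)
Lemma lit_preserving A (B : set (coin_space R)) : measurable B ->
  mu (lamp_act (lit A) @^-1` B) = mu B.
Proof.
apply: (@preserving_of_measures _ 0%N); first exact: measurable_lamp_act.
move=> n p _; have := lamp_preimage_cylinder (lit A) (- n%:Z) (2 * n) p.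
by rewrite subr0 /cylinder => ->; rewrite !coin_balanced.
Qed.

Lemma lit1E j x i : lamp_act (lit [fset j]%fset) x i = (i == j) (+) x i.
Proof. by rewrite /lamp_act inE subr0. Qed.

(** Flipping coordinate [j] preserves both the measure and [B], and exchanges the part of [B] where
    [x j = h x] with the rest of [B]. *)
Lemma coin_half j (B : set (coin_space R)) (h : coin_space R -> bool) :
  measurable B -> measurable [set x : coin_space R | x j = h x] ->
  (forall x, B x -> B (lamp_act (lit [fset j]%fset) x)) ->
  (forall x, h (lamp_act (lit [fset j]%fset) x) = h x) ->
  mu (B `&` [set x : coin_space R | x j = h x]) = ((2^-1)%:E * mu B)%E.
Proof.
move=> mB mh Bj hj; set f := lamp_act _ in Bj hj.
have fE x i : f x i = (i == j) (+) x i by exact: lit1E.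
have fK : involutive f.
  by move=> x; apply/funext => i; rewrite !fE addbA addbb.
set H := [set x : coin_space R | x j = h x].
have flip : f @^-1` (B `&` H) = B `\` H.
  apply/seteqP; split=> x /=; rewrite /H /= hj fE eqxx.
    by move=> [Bx <-]; split; [rewrite -[x]fK; exact: Bj | case: (x j)].
  by move=> [Bx xh]; split; [exact: Bj | case: (x j) (h x) xh => [] []].
have mBH : measurable (B `&` H) by exact: measurableI.
have flipE : mu (B `\` H) = mu (B `&` H) by rewrite -flip; exact: lit_preserving.
have muE : mu B = (mu (B `&` H) + mu (B `&` H))%E.
  by rewrite -{1}flipE; exact: measureDI.
have fin : mu (B `&` H) \is a fin_num by exact: fin_num_measure.
by rewrite muE -(fineK fin) -EFinD -EFinM; congr EFin; lra.
Qed.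

Lemma coin_cylinder s l p : mu (cylinder s l p) = (2 ^- l)%:E.
Proof.
elim: l => [|l IH].
  rewrite (_ : cylinder _ _ _ = setT) ?probability_setT ?invr1 //.
  exact/seteqP.
rewrite (_ : cylinder _ _ _ =
    cylinder s l p `&` [set x : coin_space R | x (s + l%:Z) = p (s + l%:Z)]); last first.
  apply/seteqP; split=> x /=.
    by move=> px; split=> [k kl|]; rewrite px // ltnS ltnW.
  move=> [px xl] k; rewrite ltnS leq_eqVlt => /orP[/eqP -> //|]; exact: px.
rewrite coin_half // ?IH.
- by rewrite -EFinM exprS invfM.
- exact: measurable_cylinder.
- exact: measurable_coord.
- move=> x px k kl; rewrite lit1E px //.
  by rewrite (_ : (_ == _) = false) //; apply/negbTE; lia.
Qed.

Lemma coin_preserving f n0 :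
  (forall n p, (n0 <= n)%N -> exists s q,
    f @^-1` [set x | balanced n p x] = cylinder s (2 * n) q) ->
  measurable_fun setT f /\ forall A, measurable A -> mu (f @^-1` A) = mu A.
Proof.
move=> fP; have mf : measurable_fun setT f.
  apply: (@measurable_of_cylinders _ n0) => n p /fP - /(_ p)[s [q fq]].
  by exists s, (2 * n)%N, q.
split=> //; apply: (@preserving_of_measures _ n0) => // n p /fP - /(_ p)[s [q ->]].
by rewrite coin_cylinder coin_balanced.
Qed.

Lemma lamp_pmp : pmp_action mu lamp_act.
Proof.
have P g : measurable_fun setT (lamp_act g) /\
    forall A, measurable A -> mu (lamp_act g @^-1` A) = mu A.
  apply: (@coin_preserving _ 0%N) => n p _.
  by exists (- n%:Z - g.2), (lamp_act g^-1%g p); exact: lamp_preimage_cylinder.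
split=> [x|g h x|g|g A mA]; [exact: lamp_act1|exact: lamp_actM|exact: (P g).1|].
exact: (P g).2.
Qed.

End CoinPreserving.

(** * The odometer and the action of BS(1,2) *)

Section Odometer.
Implicit Types (x y : int -> bool) (s c : int).

(** The digit of [z] at [2 ^ k] in its 2-adic expansion, hence meaningful for negative [z] as
    well. *)
Definition bit (k : nat) (z : int) : bool := 2 ^+ k <= (z %% 2 ^+ k.+1)%Z.

Fixpoint window_value s (l : nat) x : int :=
  if l is l'.+1 then window_value s l' x + (x (s + l'%:Z))%:Z * 2 ^+ l' else 0.

Let pow2_gt0 k : 0 < 2 ^+ k :> int. Proof. by rewrite exprn_gt0. Qed.

Lemma modz_pow2S z k :
  (z %% 2 ^+ k.+1)%Z = (z %% 2 ^+ k)%Z + (bit k z)%:Z * 2 ^+ k.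
Proof.
have M0 := pow2_gt0 k; rewrite /bit exprS.
have -> : (z %% 2 ^+ k)%Z = ((z %% (2 * 2 ^+ k))%Z %% 2 ^+ k)%Z.
  by rewrite {1}(divz_eq z (2 * 2 ^+ k)) mulrA modzMDl.
have := ltz_pmod z (_ : 0 < 2 * 2 ^+ k); have := modz_ge0 z (_ : 2 * 2 ^+ k != 0).
move: (z %% (2 * 2 ^+ k))%Z M0 => r; move: (2 ^+ k) => M M0 r0 rM.
have {}r0 : 0 <= r by apply: r0; lia.
have {}rM : r < 2 * M by apply: rM; lia.
case: (lerP M r) => /= Mr; last by rewrite modz_small; lia.
by rewrite -[in (r %% M)%Z](subrK M r) modzDr modz_small; lia.
Qed.

Lemma window_value_ge0 s l x : 0 <= window_value s l x.
Proof.
elim: l => //= l IH; have := pow2_gt0 l; case: (x _) => /=; lia.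
Qed.

Lemma window_value_lt s l x : window_value s l x < 2 ^+ l.
Proof.
elim: l => //= l IH; rewrite exprS; case: (x _) => /=; have := pow2_gt0 l; lia.
Qed.

Lemma window_value_mod s l x : (window_value s l x %% 2 ^+ l)%Z = window_value s l x.
Proof. by rewrite modz_small // window_value_ge0 window_value_lt. Qed.

Lemma window_value_eqP s l x y :
  window_value s l x = window_value s l y <-> agree s l x y.
Proof.
split; last first.
  elim: l => //= l IH xy; rewrite IH => [|k kl]; last by apply: xy; exact: ltnW.
  by rewrite xy.
elim: l => [|l IH] //= xy.
have := window_value_lt s l x; have := window_value_ge0 s l x.
have := window_value_lt s l y; have := window_value_ge0 s l y.
move: xy IH; move: (window_value s l x) (window_value s l y) => a b.
have := pow2_gt0 l; move: (2 ^+ l) => M M0 ab IH b0 bM a0 aM.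
have xyl : x (s + l%:Z) = y (s + l%:Z).
  by move: ab; case: (x _) (y _) => [] [] //=; lia.
have {}/IH xy : a = b by move: ab; rewrite xyl; lia.
by move=> k; rewrite ltnS leq_eqVlt => /orP[/eqP ->//|]; exact: xy.
Qed.

Lemma window_value_cons s l x :
  window_value (s - 1) l.+1 x = (x (s - 1))%:Z + 2 * window_value s l x.
Proof.
elim: l => [|l IH]; first by rewrite /= addr0 !mulr1 mulr0 addr0 add0r.
rewrite -[LHS]/(window_value (s - 1) l.+1 x + _) IH /= exprS.
rewrite (_ : s - 1 + _ = s + l%:Z); last by lia.
by rewrite mulrDr addrA; congr (_ + _); ring.
Qed.

(* Addition of [c * 2 ^ s] to a two-sided sequence of binary digits: the digits
   below position [s] are kept, the others form a 2-adic integer. *)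
Definition odometer s c x : int -> bool := fun i =>
  if i < s then x i else bit `|(i - s)%R| (c + window_value s `|(i - s)%R|.+1 x).

Lemma odometer_below s c x i : i < s -> odometer s c x i = x i.
Proof. by rewrite /odometer => ->. Qed.

Lemma window_value_odometer s c x l :
  window_value s l (odometer s c x) = ((c + window_value s l x) %% 2 ^+ l)%Z.
Proof.
elim: l => [|l IH] /=; first by rewrite modz1.
rewrite modz_pow2S IH; congr (_ + _); last first.
  rewrite /odometer; have -> : (s + l%:Z < s) = false by lia.
  by have -> : `|(s + l%:Z - s)%R|%N = l by lia.
by rewrite addrA [in RHS]addrC modzMDl.
Qed.

(** The characterisation of the sum by residues modulo all [2 ^ l], which turns identities between
    odometers into modular arithmetic. *)
Lemma odometer_unique s c x y : (forall i, i < s -> y i = x i) ->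
  (forall l, window_value s l y = ((c + window_value s l x) %% 2 ^+ l)%Z) ->
  y = odometer s c x.
Proof.
move=> below vals; apply/funext => i; have [is_|si] := ltP i s.
  by rewrite below // odometer_below.
have : agree s `|i - s|%N.+1 y (odometer s c x).
  by apply/window_value_eqP; rewrite vals window_value_odometer.
by move=> /(_ `|i - s|%N (ltnSn _)); rewrite (_ : s + _ = i) //; lia.
Qed.

Lemma odometer0 s x : odometer s 0 x = x.
Proof.
by apply/esym/odometer_unique => // l; rewrite add0r window_value_mod.
Qed.

Lemma odometerD s c d x : odometer s (c + d) x = odometer s c (odometer s d x).
Proof.
apply/esym/odometer_unique => [i is_|l]; first by rewrite !odometer_below.
by rewrite !window_value_odometer modzDmr addrA.
Qed.

(** An even summand leaves the lowest digit alone and creates no carry there, so the action depends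
    only on the rational [c * 2 ^ s]. *)
Lemma odometer_lift s c x : odometer (s - 1) (c * 2) x = odometer s c x.
Proof.
apply/esym/odometer_unique => [i is_|l]; first by rewrite odometer_below //; lia.
case: l => [|l]; first by rewrite /= modz1.
rewrite !window_value_cons window_value_odometer odometer_below; last by lia.
have := ltz_pmod (c + window_value s l x) (pow2_gt0 l).
have := modz_ge0 (c + window_value s l x) (lt0r_neq0 (pow2_gt0 l)).
have := divz_eq (c + window_value s l x) (2 ^+ l).
rewrite exprS; move: (window_value s l x) (pow2_gt0 l) => v; move: (2 ^+ l) => M M0.
move: ((c + v)%R %/ M)%Z ((c + v)%R %% M)%Z => q r vE r0 rM.
have -> : c * 2 + ((x (s - 1))%:Z + 2 * v) =
    q * (2 * M) + ((x (s - 1))%:Z + 2 * r) by lia.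
by rewrite modzMDl modz_small //; case: (x _) => /=; lia.
Qed.

Lemma odometer_liftn s c x (d : nat) :
  odometer (s - d%:Z) (c * 2 ^+ d) x = odometer s c x.
Proof.
elim: d => [|d IH]; first by rewrite subr0 mulr1.
by rewrite -[RHS]IH -[RHS]odometer_lift exprSr mulrA; congr odometer; lia.
Qed.

Lemma window_value_shift s m l x :
  window_value s l (fun i => x (i - m)) = window_value (s - m) l x.
Proof. by elim: l => //= l ->; rewrite addrAC. Qed.

Lemma odometer_shift s m c x :
  (fun i => odometer s c x (i - m)) = odometer (s + m) c (fun i => x (i - m)).
Proof.
apply: odometer_unique => [i im|l].
  by rewrite odometer_below // ltrBlDr.
by rewrite !window_value_shift addrK window_value_odometer.
Qed.

(** Adding [c] permutes the residues modulo [2 ^ l], so a cylinder starting at [s] pulls back to a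
    cylinder on the same window. *)
Lemma agree_odometer s l c p x :
  agree s l p (odometer s c x) <-> agree s l (odometer s (- c) p) x.
Proof.
by split=> /window_value_eqP px; apply/window_value_eqP;
  rewrite window_value_odometer; move: px; rewrite window_value_odometer;
  [move=> -> | move=> <-]; rewrite modzDmr ?addKr ?addNKr window_value_mod.
Qed.

(** A fixed point forces [2 ^ |c|] to divide [c], although [|c| < 2 ^ |c|]. *)
Lemma odometer_free s c x : odometer s c x = x -> c = 0.
Proof.
move=> cx; have c_lt : `|c|%N%:Z < 2 ^+ `|c| by rewrite -natz -natrX ltr_nat ltn_expl.
have := window_value_odometer s c x `|c|; rewrite cx.
have := divz_eq (c + window_value s `|c| x) (2 ^+ `|c|).
move: c_lt (window_value s `|c| x); move: (2 ^+ `|c|) => M cM v.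
move: ((c + v)%R %/ M)%Z ((c + v)%R %% M)%Z => q r vE rv.
have {vE rv} cE : c = q * M by move: vE; rewrite -rv; lia.
have [q0|q0] := eqVneq q 0; first by rewrite cE q0 mul0r.
move: cM; rewrite cE abszM PoszM; have : 1 <= `|q|%N%:Z by lia.
rewrite ltNge => q1 /negP[]; rewrite (le_trans (ler_norm M)) //.
by rewrite abszE ler_peMl.
Qed.

Lemma window_value_bit1 s l x k : (k < l)%N -> x (s + k%:Z) ->
  2 ^+ k <= window_value s l x.
Proof.
elim: l => // l IH; rewrite ltnS leq_eqVlt => /orP[/eqP ->|kl] xk /=.
  by rewrite xk mul1r lerDr window_value_ge0.
by rewrite ler_wpDr ?IH // mulr_ge0 // ltW.
Qed.

Lemma window_value_bit0 s l x k : (k < l)%N -> x (s + k%:Z) = false ->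
  window_value s l x + 2 ^+ k < 2 ^+ l.
Proof.
elim: l => // l IH; rewrite ltnS leq_eqVlt => /orP[/eqP ->|kl] xk /=.
  by rewrite xk mul0r addr0 exprS; have := window_value_lt s l x; lia.
have := IH kl xk; rewrite exprS; case: (x _) => /=; lia.
Qed.

(* A carry (or a borrow) dies at the first 0 (or 1) above the summand. *)
Lemma odometer_above s c x (l0 l k1 k0 : nat) (i : int) : `|c| <= 2 ^+ l0 ->
  (l0 <= k1 < l)%N -> x (s + k1%:Z) -> 
  (l0 <= k0 < l)%N -> x (s + k0%:Z) = false ->
  s + l%:Z <= i -> odometer s c x i = x i.
Proof.
move=> cl0 /andP[lk1 k1l] xk1 /andP[lk0 k0l] xk0.
(* The digit 1 at [k1] makes the window value at least [|c|], so there is no borrow; the digit 0 at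
   [k0] leaves room for [|c|], so there is no overflow. *)
have c_ge d : 0 <= c + window_value s (l + d) x.
  have := window_value_bit1 (ltn_addr d k1l) xk1.
  have : 2 ^+ l0 <= 2 ^+ k1 :> int by rewrite ler_eXn2l.
  lia.
have c_lt d : c + window_value s (l + d) x < 2 ^+ (l + d).
  have := window_value_bit0 (ltn_addr d k0l) xk0.
  have : 2 ^+ l0 <= 2 ^+ k0 :> int by rewrite ler_eXn2l.
  lia.
have E d : window_value s (l + d) (odometer s c x) = c + window_value s (l + d) x.
  by rewrite window_value_odometer modz_small // c_ge c_lt.
(* Addition is exact in the windows of length [l + d] and [l + d + 1]; comparing the two isolates
   the digit at [i]. *)
move=> si; pose d := `|(i - (s + l%:Z))%R|%N.
have := E d.+1; rewrite addnS /= E -addrA => /addrI/addrI.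
rewrite (_ : s + (l + d)%N%:Z = i); last by rewrite /d; lia.
move/(mulIf (lt0r_neq0 (pow2_gt0 (l + d)))).
by case: (odometer _ _ _ _) (x i) => [] [].
Qed.

(** Adding 1 to a digit 0, or subtracting 1 from a digit 1, causes no carry. *)
Lemma odometer_flip x :
  odometer 0 (if x 0 then -1 else 1) x = fun i => (i == 0) (+) x i.
Proof.
pose y i := (i == 0) (+) x i.
suff V l : window_value 0 l.+1 y = (if x 0 then -1 else 1) + window_value 0 l.+1 x.
  apply/esym/odometer_unique => [i i0|[|l]]; last 2 first.
  - by rewrite modz1.
  - by rewrite -V window_value_mod.
  - by rewrite (_ : (_ == _) = false) //; apply/negbTE; lia.
have := window_value_cons 1 l y; have := window_value_cons 1 l x; rewrite subrr.
have -> : window_value 1 l y = window_value 1 l x.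
  apply/window_value_eqP => k _; rewrite /y.
  by rewrite (_ : (_ == _) = false) //; apply/negbTE; lia.
by move=> -> ->; rewrite /y eqxx; case: (x 0) => /=; lia.
Qed.

End Odometer.

(** * Shifts and odometers combined into an action of BS(1,2) *)

Section BSAction.
Variable R : realType.
Notation mu := (coin R).
Implicit Types (g h : bs) (x p : coin_space R).

Lemma bs_dyadic_le g (u : int) :
  exists s c : int, s <= u /\ (bs_val g).1 = c%:~R * 2 ^ s.
Proof.
have [s [c ->]] := bs_dyadic g.
exists (s - `|u|%N%:Z - `|s|%N%:Z), (c * 2 ^+ (`|u| + `|s|)); split; first lia.
rewrite rmorphM rmorphXn /= exprnP -mulrA -expfzDr //; congr (_ * 2 ^ _); lia.
Qed.

Lemma odometer_dyadic (s t c d : int) (x : int -> bool) :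
  c%:~R * 2 ^ s = d%:~R * 2 ^ t :> rat -> odometer s c x = odometer t d x.
Proof.
wlog st : s t c d / s <= t => [th|cd].
  have [/th|/ltW ts e] := leP s t; first exact.
  exact/esym/(th _ _ _ _ ts)/esym.
have -> : c = d * 2 ^+ `|t - s|.
  apply: (@intr_inj rat); rewrite rmorphM rmorphXn /= exprnP.
  apply: (mulIf (_ : 2 ^ s != 0 :> rat)); first by rewrite expfz_neq0.
  by rewrite cd -mulrA -expfzDr //; congr (_ * 2 ^ _); lia.
have {1}-> : s = t - `|t - s|%N%:Z by lia.
exact: odometer_liftn.
Qed.

(** The representation [c * 2 ^ s] of the translation part is chosen arbitrarily; [bs_actE] shows
    that any other gives the same result. *)
Definition bs_act g x : coin_space R :=
  let sc := cid (bs_dyadic g) in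
  odometer (sval sc) (sval (cid (svalP sc))) (fun i => x (i - (bs_val g).2)).

Lemma bs_actE g x s c : (bs_val g).1 = c%:~R * 2 ^ s ->
  bs_act g x = odometer s c (fun i => x (i - (bs_val g).2)).
Proof.
move=> gE; apply: odometer_dyadic; rewrite -gE.
exact/esym/(svalP (cid (svalP (cid (bs_dyadic g))))).
Qed.

Lemma bs_act1 x : bs_act 1%g x = x.
Proof.
rewrite (@bs_actE _ _ 0 0) ?mul0r // odometer0.
by apply/funext => i; rewrite subr0.
Qed.

Lemma bs_actM g h x : bs_act (g * h)%g x = bs_act g (bs_act h x).
Proof.
have [s [c [_ gE]]] := bs_dyadic_le g 0.
(* The exponent [t] is taken so low that, once shifted by [g], the summand of [h] starts no higher
   than that of [g]; both are then added at position [t + (bs_val g).2]. *)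
have [t [d [ts hE]]] := bs_dyadic_le h (s - (bs_val g).2).
pose e : nat := `|(s - (t + (bs_val g).2))%R|%N.
have gE' : (bs_val g).1 = (c * 2 ^+ e)%:~R * 2 ^ (t + (bs_val g).2).
  rewrite /e gE rmorphM rmorphXn /= exprnP -mulrA -expfzDr //.
  by congr (_ * 2 ^ _); lia.
have ghE : (bs_val (g * h)%g).1 =
    (c * 2 ^+ e + d)%:~R * 2 ^ (t + (bs_val g).2).
  rewrite rmorphD mulrDl -gE' /= hE; congr (_ + _).
  by rewrite mulrCA -expfzDr // addrC.
rewrite (bs_actE _ ghE) (bs_actE _ gE') (bs_actE _ hE) odometer_shift odometerD.
by congr (odometer _ _ (odometer _ _ _)); apply/funext => i; congr x => /=; lia.
Qed.

Lemma bs_pmp : pmp_action mu bs_act.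
Proof.
have P g : measurable_fun setT (bs_act g) /\
    forall A, measurable A -> mu (bs_act g @^-1` A) = mu A.
  have [s [c gE]] := bs_dyadic g.
  (* A window with [n >= |s|] starts at or below [s], so the summand can be rewritten to start
     exactly at [-n], where [agree_odometer] applies. *)
  apply: (@coin_preserving _ _ `|s|%N) => n p sn.
  have gn : (bs_val g).1 = (c * 2 ^+ `|s + n%:Z|)%:~R * 2 ^ (- n%:Z).
    rewrite gE rmorphM rmorphXn /= exprnP -mulrA -expfzDr //.
    by congr (_ * 2 ^ _); lia.
  pose m : lamp := (fset0, (bs_val g).2).
  pose q : coin_space R := odometer (- n%:Z) (- (c * 2 ^+ `|s + n%:Z|)) p.
  exists (- n%:Z - m.2), (lamp_act m^-1%g q).
  rewrite -lamp_preimage_cylinder; apply/seteqP.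
  have E x : bs_act g x = odometer (- n%:Z) (c * 2 ^+ `|s + n%:Z|) (lamp_act m x).
    by rewrite (bs_actE _ gn); congr odometer;
      apply/funext => i; rewrite /lamp_act inE.
  by split=> x; rewrite /cylinder /= /balanced E => /agree_odometer; rewrite ?opprK.
split=> [x|g h x|g|g A mA]; [exact: bs_act1|exact: bs_actM|exact: (P g).1|].
exact: (P g).2.
Qed.

Lemma bs_act_fixed g x : bs_act g x = x ->
  g = 1%g \/ (bs_val g).2 != 0 /\
    exists K, forall i, i < K -> x (i - (bs_val g).2) = x i.
Proof.
have [s [c gE]] := bs_dyadic g; rewrite (bs_actE _ gE) => gx.
have [m0|m0] := eqVneq (bs_val g).2 0; [left | right; split=> //].
  apply: bs_val_inj; move: gx gE; rewrite m0.
  rewrite (_ : (fun i => x (i - 0)) = x); last by apply/funext => i; rewrite subr0.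
  move=> /odometer_free -> ; rewrite mul0r; move: m0.
  by case: (bs_val g) => a b /= -> ->.
by exists s => i is_; rewrite -[in RHS]gx odometer_below.
Qed.

Lemma lamp_act_fixed (g : lamp) x : lamp_act g x = x ->
  g = 1%g \/ g.2 != 0 /\ exists K, forall i, i < K -> x (i - g.2) = x i.
Proof.
case: g => A m gx; have [m0|m0] := eqVneq m 0; [left | right; split=> //].
  rewrite m0 in gx *; congr pair; apply/fsetP => i; rewrite inE.
  have := congr1 (fun y : coin_space R => y i) gx; rewrite /lamp_act /= subr0.
  by case: (i \in A) (x i) => [] [].
(* Every element of [A] is at least this bound, so only the shift acts below it. *)
exists (- (\sum_(i <- A) `|i|)%N%:Z) => i iA.
rewrite -[in RHS]gx /lamp_act /= (_ : (_ \in _) = false) //.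
apply/negP => /= iA'; move: iA; rewrite (big_fsetD1 i) //=.
move: (\sum_(_ <- _) _)%N => a; lia.
Qed.

Lemma bs_act_a (b : bool) x :
  bs_act (letter bs_gen (ord0, b)) x = odometer 0 (if b then -1 else 1) x.
Proof.
rewrite (@bs_actE _ _ 0 (if b then -1 else 1)); last first.
  by case: b; rewrite /= ?oppr0 ?mulr1.
by congr odometer; apply/funext => i; case: b; rewrite /= ?oppr0 subr0.
Qed.

Lemma bs_act_t (b : bool) x :
  bs_act (letter bs_gen (ord_max, b)) x = fun i => x (i - (if b then -1 else 1)).
Proof.
rewrite (@bs_actE _ _ 0 0); last by case: b; rewrite /= ?mulr0 ?oppr0 ?mul0r.
by rewrite odometer0; apply/funext => i; case: b.
Qed.

(* Lighting the lamp at 0 adds or subtracts 1, so generators of the lamplighter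
   group act pointwise as generators of the Baumslag-Solitar group. *)
Lemma lamp_letter_bs_letter (l : 'I_2 * bool) x :
  exists l', bs_act (letter bs_gen l') x = lamp_act (letter lamp_gen l) x.
Proof.
case: l => i b; have [->|->] : i = ord0 \/ i = ord_max.
  by case: i => [[|[|//]] lt]; [left | right]; apply: val_inj.
- exists (ord0, x 0); rewrite bs_act_a odometer_flip; apply/funext => j.
  by case: b; rewrite /lamp_act /letter /= ?in_translate ?oppr0 ?subr0 inE.
- exists (ord_max, b); rewrite bs_act_t; apply/funext => j.
  by case: b; rewrite /lamp_act /letter /= ?in_translate ?inE.
Qed.

Lemma lamp_word_bs_word (w : word 2) x : exists2 v : word 2, size v = size w &
  bs_act (eval_word bs_gen v) x = lamp_act (eval_word lamp_gen w) x.
Proof.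
elim: w => [|l w [v vw vx]].
  by exists [::] => //; rewrite /eval_word !big_nil bs_act1 lamp_act1.
have [l' lx] := lamp_letter_bs_letter l (lamp_act (eval_word lamp_gen w) x).
exists (l' :: v); first by rewrite /= vw.
rewrite !eval_word_cons -!/(letter _ _) bs_actM vx lx.
by rewrite lamp_actM.
Qed.

(** Over the denominator [2 ^ (N + 1)], a further letter turns the numerator [c] into
    [2 c + 2^(N+1)], [2 c - 2^(N+1)], [4 c] or [c]; each is at most [4 ^ (N + 1)] in absolute
    value. *)
Lemma bs_word_bound (w : word 2) : exists c : int,
  [/\ (bs_val (eval_word bs_gen w)).1 = c%:~R * 2 ^ (- (size w)%:Z),
      `|c| <= 4 ^+ size w & (`|(bs_val (eval_word bs_gen w)).2| <= size w)%N].
Proof.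
elim: w => [|[i b] w [c [qE cle mle]]].
  by exists 0; rewrite /eval_word big_nil mul0r; split.
have p2 : (2 : rat) ^ (- (size w)%:Z) = 2 * 2 ^ (- (size w).+1%:Z).
  by rewrite -[X in X * _]/(2 ^ 1) -expfzDr //; congr (2 ^ _); lia.
have p1 : (1 : rat) = (2 ^+ (size w).+1)%:~R * 2 ^ (- (size w).+1%:Z).
  by rewrite rmorphXn /= exprnP -expfzDr // addrN.
have two : 2 ^+ (size w).+1 <= 2 * 4 ^+ size w :> int.
  by rewrite exprS ler_pM2l // lerXn2r ?nnegrE.
have [->|->] : i = ord0 \/ i = ord_max.
  by case: i => [[|[|//]] lt]; [left | right]; apply: val_inj.
- case: b; [exists (c * 2 - 2 ^+ (size w).+1)|exists (c * 2 + 2 ^+ (size w).+1)];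
    rewrite ?eval_a ?eval_aV; split; try by rewrite leqW.
  + by rewrite /= qE p2 intrB mulrBl -p1 intrM -mulrA.
  + by rewrite [size (_ :: _)]/= (exprS 4); lia.
  + by rewrite /= qE p2 intrD [RHS]mulrDl -p1 intrM -mulrA.
  + by rewrite [size (_ :: _)]/= (exprS 4); lia.
- case: b; [exists c | exists (c * 4)]; rewrite ?eval_t ?eval_tV; split;
    try (rewrite /=; lia).
  + by rewrite /= qE p2 mulrCA mulKf.
  + by rewrite [size (_ :: _)]/= (exprS 4); lia.
  + by rewrite /= qE p2 intrM mulrCA -!mulrA; congr (_ * _); rewrite mulrA.
  + by rewrite [size (_ :: _)]/= (exprS 4); lia.
Qed.

End BSAction.

(** * Freeness and equality of orbits *)

Section Coincidences.
Variable R : realType.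
Notation mu := (coin R).
Implicit Types (u v : nat -> int) (x : coin_space R).

Definition coincide u v (J : nat) : set (coin_space R) :=
  [set x | forall j, (j < J)%N -> x (u j) = x (v j)].

Lemma measurable_eq_coord (i j : int) : measurable [set x : coin_space R | x i = x j].
Proof.
rewrite (_ : [set x : coin_space R | x i = x j] = \bigcup_(b in [set: bool])
    ([set x : coin_space R | x i = b] `&` [set x : coin_space R | x j = b])).
  apply: fin_bigcup_measurable => // b _.
  by apply: measurableI; exact: measurable_coord.
by apply/seteqP; split=> [x /= xij|x [b _ [/= -> ->]]] //; exists (x i).
Qed.

Lemma coincideS u v J : coincide u v J.+1 =
  coincide u v J `&` [set x : coin_space R | x (u J) = x (v J)].
Proof.
apply/seteqP; split=> [x xuv|x [xuv xJ] j].
  by split=> [j jJ|]; apply: xuv; rewrite // ltnS ltnW.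
by rewrite ltnS leq_eqVlt => /orP[/eqP ->//|]; exact: xuv.
Qed.

Lemma measurable_coincide u v J : measurable (coincide u v J).
Proof.
elim: J => [|J IH].
  by rewrite (_ : coincide u v 0 = setT) //; exact/seteqP.
by rewrite coincideS; apply: measurableI => //; exact: measurable_eq_coord.
Qed.

(* Each new equation involves a fresh coordinate [u J], so it halves the measure. *)
Lemma coin_coincide u v J :
  (forall i j, (j < i)%N -> u j != u i) -> (forall i j, (j <= i)%N -> v j != u i) ->
  mu (coincide u v J) = (2 ^- J)%:E.
Proof.
move=> uu vu; elim: J => [|J IH].
  rewrite (_ : coincide u v 0 = setT) ?probability_setT ?invr1 //.
  exact/seteqP.
rewrite coincideS (@coin_half _ (u J) (coincide u v J) (fun x => x (v J))).
- by rewrite IH -EFinM exprS invfM.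
- exact: measurable_coincide.
- exact: measurable_eq_coord.
- move=> x xuv j jJ; rewrite !lit1E (negPf (uu _ _ jJ)) (negPf (vu _ _ (ltnW jJ))).
  exact: xuv.
- by move=> x; rewrite lit1E (negPf (vu _ _ (leqnn J))).
Qed.

Lemma coin_coincide_all u v :
  (forall i j, (j < i)%N -> u j != u i) -> (forall i j, (j <= i)%N -> v j != u i) ->
  mu.-negligible [set x | forall j, x (u j) = x (v j)].
Proof.
move=> uu vu; exists (\bigcap_J coincide u v J); split.
- by apply: bigcapT_measurable => J; exact: measurable_coincide.
- apply/eqP; rewrite eq_le measure_ge0 andbT; apply/lee_addgt0Pr => e e0.
  have [J _ /(_ J (leqnn _)) Je] := near_infty_natSinv_expn_lt (PosNum e0).
  rewrite add0e; apply: (@le_trans _ _ (mu (coincide u v J))).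
    apply: le_measure; rewrite ?inE.
    - by apply: bigcapT_measurable => ?; exact: measurable_coincide.
    - exact: measurable_coincide.
    - exact: bigcap_inf.
  by rewrite coin_coincide // lee_fin ltW // -div1r.
- by move=> x xuv J _ j _; exact: xuv.
Qed.

Lemma eventually_periodic_negligible (m K : int) : m != 0 ->
  mu.-negligible [set x : coin_space R | forall i, i < K -> x (i - m) = x i].
Proof.
wlog m0 : m K / 0 < m => [th mn0|_].
  have [m0|m0] := ltP 0 m; first exact: th.
  have := th (- m) (K - m); rewrite oppr_gt0 oppr_eq0 lt_neqAle mn0 m0 => /(_ isT isT).
  apply: negligibleS => x /= xm i iK; have := xm (i + m).
  by rewrite addrK opprK => -> //; lia.
(* The equations are listed from right to left, so each left-hand coordinate lies to the left of all
   coordinates used before. *)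
have neg := @coin_coincide_all (fun j => K - 1 - j%:Z - m) (fun j => K - 1 - j%:Z).
apply: negligibleS (neg _ _) => [x /= xm j|i j|i j]; last 2 first.
- by move=> ij; apply/negP => /eqP; lia.
- by move=> ij; apply/negP => /eqP; lia.
- by apply: xm; lia.
Qed.

(** The run of equal digits starting at [b] reaches at least [b + k]; this event controls the length
    of the terminal carry. *)
Definition const_run (b : int) (k : nat) : set (coin_space R) :=
  coincide (fun j => b + 1 + j%:Z) (fun=> b) k.

Lemma coin_const_run b k : mu (const_run b k) = (2 ^- k)%:E.
Proof. by apply: coin_coincide => i j ij; apply/negP => /eqP; lia. Qed.

Lemma negligible_countable_bigcup (I : countType) (F : I -> set (coin_space R)) :
  (forall i, mu.-negligible (F i)) -> mu.-negligible (\bigcup_i F i).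
Proof.
move=> negF.
have : mu.-negligible
    (\bigcup_k (if choice.unpickle k is Some i then F i else set0)).
  apply: negligible_bigcup => k; case: (choice.unpickle k) => //.
  exact: negligible_set0.
by apply: negligibleS => x [i _ Fx]; exists (choice.pickle i); rewrite // choice.pickleK.
Qed.

Lemma aperiodic_ae : \forall x \ae mu, forall m K : int, m != 0 ->
  ~ (forall i, i < K -> x (i - m) = x i).
Proof.
have : mu.-negligible (\bigcup_(mK : int * int) (if mK.1 != 0 then
    [set x : coin_space R | forall i, i < mK.2 -> x (i - mK.1) = x i] else set0)).
  apply: negligible_countable_bigcup => -[m K] /=.
  by case: ifP => m0; [exact: eventually_periodic_negligible | exact: negligible_set0].
apply: negligibleS => x /= /existsNP[m /existsNP[K /not_implyP[m0 /contrapT xm]]].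
by exists (m, K); rewrite //= m0.
Qed.

Lemma not_eventually_constant_ae :
  \forall x \ae mu, forall b, exists k, ~ const_run b k x.
Proof.
have : mu.-negligible (\bigcup_b
    [set x : coin_space R | forall j : nat, x (b + 1 + j%:Z) = x b]).
  apply: negligible_countable_bigcup => b.
  by apply: (@coin_coincide_all (fun j => b + 1 + j%:Z) (fun=> b)) => i j ij;
    apply/negP => /eqP; lia.
apply: negligibleS => x /= /existsNP[b /forallNP xb]; exists b => //= j.
have /contrapT/(_ j) := xb j.+1; exact.
Qed.

Lemma lamp_ae_free : ae_free mu (@lamp_act R).
Proof.
apply: negligibleS aperiodic_ae => x nfree ap.
apply: nfree => g /lamp_act_fixed[//|[m0 [K]]].
by move/(ap _ _ m0).
Qed.

Lemma bs_ae_free : ae_free mu (@bs_act R).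
Proof.
apply: negligibleS aperiodic_ae => x nfree ap.
apply: nfree => g /bs_act_fixed[//|[m0 [K]]].
by move/(ap _ _ m0).
Qed.

Lemma bs_word_lamp_word (w : word 2) : exists b, forall x k, ~ const_run b k.+1 x ->
  exists2 v : word 2,
    lamp_act (eval_word lamp_gen v) x = bs_act (eval_word bs_gen w) x &
    (size v <= 7 * size w + 3 * k + 6)%N.
Proof.
have [c [qE cle mle]] := bs_word_bound w.
set m := (bs_val _).2 in qE mle *; set N := size w in qE cle mle *.
(* Since [|c| <= 2 ^ (2 N)] and the summand starts at [-N], [odometer_above] needs digits from
   position [N] on; position [N] of the shifted sequence [z] is position [N - m] of [x]. *)
exists (N%:Z - m) => x k /existsNP[j /not_implyP[jk xj]].
(* The length [r] exceeds the indices [2 N] and [2 N + j + 1], where [j <= k]. The digits of [z]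
   there differ, so one is 0 and the other 1, and the carry has died before index [r]. *)
pose z : coin_space R := fun i => x (i - m); pose r := (2 * N + k + 2)%N.
pose y : coin_space R := odometer (- N%:Z) c z.
have above i : - N%:Z + r%:Z <= i -> y i = z i.
  have cle' : `|c| <= 2 ^+ (2 * N) by rewrite exprM.
  have E0 : - N%:Z + (2 * N)%N%:Z = N%:Z by lia.
  have E1 : - N%:Z + (2 * N + j).+1%N%:Z = N%:Z + 1 + j%:Z by lia.
  have zj : z (N%:Z + 1 + j%:Z) <> z N%:Z.
    by move=> e; apply: xj; rewrite -/(z N%:Z) -e /z; congr x; lia.
  have [zN|zN] := boolP (z N%:Z).
  - apply: (odometer_above (k1 := 2 * N) (k0 := (2 * N + j).+1) cle');
      rewrite ?E0 ?E1 //.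
    + by rewrite /r; lia.
    + by rewrite /r; lia.
    + by apply/negbTE/negP => e; apply: zj; rewrite e zN.
  - apply: (odometer_above (k1 := (2 * N + j).+1) (k0 := 2 * N) cle');
      rewrite ?E0 ?E1 //.
    + by rewrite /r; lia.
    + by apply/negbNE/negP => /negPf e; apply: zj; rewrite e (negPf zN).
    + by rewrite /r; lia.
    + exact/negbTE.
pose dig (l : nat) : int := - N%:Z + l%:Z.
pose A : {fset int} := [fset i in [seq dig l | l <- iota 0 r] | y i != z i]%fset.
have AP i : (i \in A) = (y i != z i).
  rewrite !inE /= andb_idl // => yz; apply/mapP.
  have lo : - N%:Z <= i.
    by rewrite leNgt; apply: contra yz => iN; rewrite /y odometer_below.
  have hi : i < - N%:Z + r%:Z by rewrite ltNge; apply: contra yz => iN; rewrite above.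
  by exists `|(i + N%:Z)%R|%N; rewrite /dig ?mem_iota; lia.
have [i|v vE vs] := @lamp_word_window A m (- N%:Z) r.
  rewrite !inE /= => /andP[/mapP[l]]; rewrite mem_iota => /andP[_ lr] -> _.
  by rewrite /dig; lia.
(* The length is at most [N + 2 r + |m - N - k - 2|], and [|m| <= N]. *)
exists v; last by move: vs mle; rewrite /r; lia.
rewrite vE (bs_actE _ qE); apply/funext => i.
rewrite /lamp_act /= AP -/m -/(z i) -[odometer _ _ _]/y.
by case: (y i) (z i) => [] [].
Qed.

End Coincidences.

(** * The orbit equivalence coupling *)

Section Coupling.
Variable R : realType.
Notation mu := (coin R).

Lemma coin_space_standard : standard_borel R (coin_space R).
Proof.
exists (conf R), id; split.
- exact: conf_separable.
- exact: conf_complete.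
- by exists id.
- by move=> A; rewrite image_id.
Qed.

Lemma lamp_bs_orbits : \forall x \ae mu,
  range (@lamp_act R ^~ x) = range (@bs_act R ^~ x).
Proof.
apply: negligibleS (@not_eventually_constant_ae R) => x xorb nconst; apply: xorb.
apply/seteqP; split=> _ [g _ <-].
  have [w <-] := lamp_gen_surjective g.
  by have [v _ vx] := lamp_word_bs_word w x; exists (eval_word bs_gen v).
have [w <-] := bs_gen_surjective g; have [b bP] := @bs_word_lamp_word R w.
(* A run of length 0 is no condition, so the failing length is a successor. *)
have [[|k] kx] := nconst b; first by exfalso; apply: kx.
by have [v vx _] := bP x k kx; exists (eval_word lamp_gen v).
Qed.

Definition lamp_bs_coupling : oe_coupling R lamp bs :=
  OECoupling coin_space_standard (lamp_pmp R) (bs_pmp R)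
    (@lamp_ae_free R) (@bs_ae_free R) lamp_bs_orbits.

End Coupling.

(** * Integrability *)

Section Integrals.
Variable R : realType.
Notation mu := (coin R).
Local Open Scope ereal_scope.

(* Being a supremum over simple functions, the integral is monotone on arbitrary
   nonnegative functions; [ge0_le_integral] would require orbit distances to be
   measurable. *)
Lemma ge0_integral_le d (T : measurableType d) (m : {measure set T -> \bar R})
    (f g : T -> \bar R) : (forall x, 0 <= f x) -> (forall x, f x <= g x) ->
  \int[m]_x f x <= \int[m]_x g x.
Proof.
move=> f0 fg; rewrite !ge0_integralTE //; last first.
  by move=> x; exact: le_trans (fg x).
apply: ereal_sup_le => _ [h hf <-]; exists h => // x.
exact: le_trans (hf x) (fg x).
Qed.

Lemma integral_le_cst (f : coin_space R -> \bar R) (M : R) :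
  (forall x, 0 <= f x) -> (forall x, f x <= M%:E) -> \int[mu]_x f x <= M%:E.
Proof.
move=> f0 fM; apply: le_trans (ge0_integral_le mu f0 fM) _.
by rewrite integral_cst // [X in _ * X]probability_setT mule1.
Qed.

(** [f] is dominated by the sum of [a * z ^ k] times the indicator of [const_run b k], an event of
    measure [2 ^- k]; integration gives a geometric series of ratio [z / 2]. *)
Lemma integral_le_const_run (f : coin_space R -> \bar R) (b : int) (a z : R) :
  (0 < a)%R -> (1 <= z < 2)%R -> (forall x, 0 <= f x) ->
  (forall x k, ~ const_run b k.+1 x -> f x <= (a * z ^+ k)%:E) ->
  \int[mu]_x f x <= (a / (1 - z / 2))%:E.
Proof.
move=> a0 /andP[z1 z2] f0 fP.
have z0 : (0 < z)%R by exact: lt_le_trans z1.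
have az0 k : (0 < a * z ^+ k)%R by rewrite mulr_gt0 ?exprn_gt0.
pose h k (x : coin_space R) := (a * z ^+ k)%:E * (\1_(@const_run R b k) x)%:E.
have h0 k x : 0 <= h k x by rewrite mule_ge0 ?lee_fin // ltW.
have mE k : measurable (@const_run R b k) by exact: measurable_coincide.
have mh k : @measurable_fun _ _ (coin_space R) (\bar R) setT (h k).
  apply: emeasurable_funM; first exact: measurable_cst.
  by apply/measurable_EFinP; exact: measurable_indic.
have fh x : f x <= \sum_(k <oo) h k x.
  have [ex|all] := pselect (exists k, ~~ `[< const_run b k.+1 x >]).
    case: (ex_minnP ex) => k /asboolPn nk kmin.
    have xk : const_run b k x.
      case: k nk kmin => [//|k] nk kmin; apply: contrapT => /asboolPn/kmin.
      by rewrite ltnn.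
    apply: le_trans (fP x k nk) _.
    apply: le_trans (nneseries_lim_ge k.+1 (fun k _ _ => h0 k x)).
    rewrite big_nat_recr //= -[leLHS]add0e leeD ?sume_ge0 // /h indicE mem_set //.
    by rewrite mule1.
  (* If the run never ends, every term is at least [a] because [z >= 1], and the series diverges. *)
  suff -> : \sum_(k <oo) h k x = +oo by rewrite leey.
  apply/eqyP => A A0.
  pose n := `|Num.ceil (A / a)|%N.
  apply: le_trans (nneseries_lim_ge n (fun k _ _ => h0 k x)).
  have An : (A <= a * n%:R)%R.
    rewrite mulrC -ler_pdivrMr //; apply: le_trans (ceil_ge _) _.
    by rewrite /n natr_absz ler_int ler_norm.
  apply: (@le_trans _ _ (\sum_(0 <= k < n) a%:E)).
    by rewrite sumEFin big_const_nat iter_addr addr0 subn0 lee_fin -mulr_natr.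
  apply: lee_sum => k _; rewrite /h indicE mem_set; last first.
    case: k => [//|k]; apply: contrapT => /asboolPn nk; apply: all; by exists k.
  by rewrite mule1 lee_fin ler_peMr ?exprn_ege1 // ltW.
apply: le_trans (ge0_integral_le mu f0 fh) _.
rewrite integral_nneseries //.
apply: lime_le; first by apply: is_cvg_nneseries => k _ _; exact: integral_ge0.
apply: nearW => n; rewrite (eq_bigr (fun k => (geometric a (z / 2) k)%:E)).
  rewrite sumEFin lee_fin; apply: geometric_le_lim; rewrite ?ltW //.
    by rewrite divr_gt0.
  by rewrite ger0_norm ?divr_ge0 ?ltW // ltr_pdivrMr // mul1r.
move=> k _; rewrite ge0_integralZl_EFin //; last 2 first.
- by apply/measurable_EFinP; exact: measurable_indic.
- exact: ltW.
rewrite integral_indic // setIT [X in _ * X](coin_const_run R b k) -EFinM.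
by rewrite /geometric /= expr_div_n mulrA.
Qed.

End Integrals.

Lemma word_length_attained (R : realType) n (G : groupType) (x : 'I_n -> G) g :
  (exists w, eval_word x w = g) ->
  exists2 w, eval_word x w = g &
    word_length R (range (letter x)) g = (size w)%:R%:E.
Proof.
move=> gx; have ex : exists N, `[< exists2 w, eval_word x w = g & size w = N >].
  by have [w wg] := gx; exists (size w); apply/asboolP; exists w.
case: (ex_minnP ex) => N /asboolP[w wg wN] Nmin; exists w => //.
apply/eqP; rewrite eq_le -{1}wg word_length_eval /=.
apply: word_length_ge => v vg; rewrite lee_fin ler_nat wN; apply: Nmin.
by apply/asboolP; exists v.
Qed.

Section Integrability.
Variable R : realType.
Notation mu := (coin R).
Notation SG := (range (letter lamp_gen)).
Notation SL := (range (letter bs_gen)).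
Notation dG := (orbit_dist R SG (@lamp_act R)).
Notation dL := (orbit_dist R SL (@bs_act R)).
Local Open Scope ereal_scope.

Lemma orbit_dist_ge0 (G : groupType) (S : set G) (X : Type) (a : G -> X -> X) x y :
  0 <= orbit_dist R S a x y.
Proof.
apply: le_ereal_inf_tmp => _ [g _ <-].
by apply: le_ereal_inf_tmp => _ [w _ <-]; rewrite lee_fin.
Qed.

Lemma orbit_dist_eval n (G : groupType) (x : 'I_n -> G) (X : Type)
    (a : G -> X -> X) y w :
  orbit_dist R (range (letter x)) a y (a (eval_word x w) y) <= (size w)%:R%:E.
Proof.
apply: le_trans (word_length_eval _ x w).
by apply: ereal_inf_lbound; exists (eval_word x w).
Qed.

Lemma dL_lamp_word (w : word 2) x :
  dL x (lamp_act (eval_word lamp_gen w) x) <= (size w)%:R%:E.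
Proof.
have [v <- <-] := lamp_word_bs_word w x; exact: orbit_dist_eval.
Qed.

Lemma dG_bs_word (w : word 2) : exists b, forall x k, ~ const_run b k.+1 x ->
  dG x (bs_act (eval_word bs_gen w) x) <= (7 * size w + 3 * k + 6)%N%:R%:E.
Proof.
have [b bP] := @bs_word_lamp_word R w; exists b => x k /bP[v <- vk].
by apply: le_trans (orbit_dist_eval _ _ _ _) _; rewrite lee_fin ler_nat.
Qed.

(* Small enough for [7 * exp_rate eps <= eps] and for the geometric law of the
   carries to have a finite exponential moment: [expR (3 * exp_rate eps) < 2]. *)
Definition exp_rate (eps : R) : R := (Num.min (eps / 7) (ln (3 / 2) / 3))%R.

Lemma exp_rate_gt0 eps : (0 < eps -> 0 < exp_rate eps)%R.
Proof.
move=> e0; rewrite /exp_rate lt_min; apply/andP; split; first by rewrite divr_gt0.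
by rewrite divr_gt0 // ln_gt0 // ltr_pdivlMr //; lra.
Qed.

Lemma exp_rate_le eps : (7 * exp_rate eps <= eps)%R.
Proof. by rewrite mulrC -ler_pdivlMr // ge_min lexx. Qed.

Lemma exp_rate_base eps : (0 < eps -> 1 <= expR (3 * exp_rate eps) <= 3 / 2)%R.
Proof.
move=> e0; apply/andP; split.
  by rewrite -expR0 ler_expR mulr_ge0 // ltW // exp_rate_gt0.
have h : (0 < 3 / 2 :> R)%R by lra.
rewrite -(lnK h) ler_expR mulrC -ler_pdivlMr //.
by rewrite /exp_rate ge_min lexx orbT.
Qed.

(** The function [phi] will be an exponential for strong integrability and a power for the [p]-th
    moments. *)
Lemma integral_dG_bs_word (w : word 2) (eps C : R) (phi : \bar R -> \bar R) :
  (0 < eps)%R -> (0 < C)%R -> (forall t, 0 <= phi t) ->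
  (forall t (M : R), 0 <= t -> t <= M%:E ->
    phi t <= (C * expR (exp_rate eps * M))%:E) ->
  \int[mu]_x phi (dG x (bs_act (eval_word bs_gen w) x)) <=
    (4 * C * expR (6 * exp_rate eps) * expR (eps * (size w)%:R))%:E.
Proof.
move=> e0 C0 phi0 phiC; have [b bP] := dG_bs_word w.
set d := exp_rate eps; have /andP[z1 z2] := exp_rate_base e0; rewrite -/d in z1 z2.
pose N : R := (size w)%:R.
apply: le_trans (integral_le_const_run (b := b) (a := C * expR (d * (7 * N + 6)))
  (z := expR (3 * d)) _ _ _ _) _.
- by rewrite mulr_gt0 ?expR_gt0.
- by rewrite z1 /=; apply: le_lt_trans z2 _; lra.
- by move=> x; exact: phi0.
- move=> x k /bP /(phiC _ _ (orbit_dist_ge0 _ _ _ _)) /le_trans; apply.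
  rewrite lee_fin -mulrA ler_pM2l // -expRM_natl -expRD ler_expR -/d.
  have -> : ((7 * size w + 3 * k + 6)%N%:R = 7 * N + 3 * k%:R + 6 :> R)%R.
    by rewrite natrD natrD natrM natrM.
  by rewrite le_eqVlt; apply/orP; left; apply/eqP; ring.
(* The factor 4 comes from [1 - z / 2 >= 1 / 4], as [z <= 3 / 2]. *)
- rewrite lee_fin ler_pdivrMr; last by lra.
  have le1 : (expR (d * (7 * N + 6)) <= expR (6 * d) * expR (eps * N))%R.
    rewrite -expRD ler_expR mulrDr addrC (mulrC d 6%R) lerD2l mulrA (mulrC d).
    by rewrite ler_wpM2r // exp_rate_le.
  rewrite -/N (_ : (4 * C * expR (6 * d) * expR (eps * N) =
    4 * (C * (expR (6 * d) * expR (eps * N))))%R); last by ring.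
  have := mulr_gt0 C0 (mulr_gt0 (expR_gt0 (6 * d)%R) (expR_gt0 (eps * N)%R)).
  move: le1; rewrite -(ler_pM2l C0) => le1 pos; apply: le_trans le1 _.
  move: (C * _)%R pos => B B0; nra.
Qed.

(** The inequality [y <= expR y] at [y = d * M / p], raised to the power [p]. *)
Lemma powR_le_expR (p d M : R) : (0 < p)%R -> (0 < d)%R -> (0 <= M)%R ->
  (M `^ p <= (p / d) `^ p * expR (d * M))%R.
Proof.
move=> p0 d0 M0; set y := (d * M / p)%R.
have y0 : (0 <= y)%R by rewrite divr_ge0 ?mulr_ge0 ?(ltW p0) ?(ltW d0).
have -> : M = (p / d * y)%R by rewrite /y; field; rewrite !gt_eqF.
rewrite (powRM _ (divr_ge0 (ltW p0) (ltW d0)) y0).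
rewrite ler_pM2l; last by rewrite powR_gt0 // divr_gt0.
have -> : (d * (p / d * y) = p * y)%R by field; rewrite gt_eqF.
have -> : expR (p * y) = (expR y `^ p)%R by rewrite /powR gt_eqF ?expR_gt0 // expRK.
rewrite ge0_ler_powR ?nnegrE ?expR_ge0 ?(ltW p0) //.
by apply: le_trans (expR_ge1Dx y); rewrite lerDr.
Qed.

Lemma strongly_exp_lr :
  strongly_exp_integrable_lr SG SL (lamp_bs_coupling R).
Proof.
move=> eps e0; exists eps, 1%R; split=> // g; rewrite mul1e.
have [w <- ->] := word_length_attained R (lamp_gen_surjective g).
apply: integral_le_cst => x; first exact: expeR_ge0.
rewrite -[leRHS]/(expeR (eps%:E * (size w)%:R%:E)) lee_expeR.
by rewrite lee_pmul2l ?lte_fin // dL_lamp_word.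
Qed.

Lemma strongly_exp_rl :
  strongly_exp_integrable_rl SG SL (lamp_bs_coupling R).
Proof.
move=> eps e0; set d := exp_rate eps.
exists d, (4 * 1 * expR (6 * d))%R.
split; rewrite ?exp_rate_gt0 ?mulr_gt0 ?expR_gt0 // => g.
have [w <- ->] := word_length_attained R (bs_gen_surjective g).
apply: (integral_dG_bs_word w (phi := fun t => expeR (d%:E * t)) e0 ltr01)
  => [t|t M t0 tM].
  exact: expeR_ge0.
rewrite mul1r -[leRHS]/(expeR (d%:E * M%:E)) lee_expeR lee_pmul2l //.
by rewrite lte_fin; exact: exp_rate_gt0.
Qed.

Lemma lamp_bs_LpLp (p : R) : (1 <= p)%R -> LpLp_integrable SG SL (lamp_bs_coupling R) p.
Proof.
move=> p1; have p0 : (0 < p)%R by exact: lt_le_trans p1.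
split=> g.
- have [w <-] := lamp_gen_surjective g.
  apply: le_lt_trans (ltry ((size w)%:R `^ p)%R).
  apply: integral_le_cst => x; first exact: poweR_ge0.
  rewrite -poweR_EFin; apply: gt0_ler_poweR; rewrite ?(ltW p0) ?in_itv /= ?leey ?andbT //.
  + exact: orbit_dist_ge0.
  + exact: dL_lamp_word.
- have [w <-] := bs_gen_surjective g.
  (* Only finiteness is at stake, so the single value [eps = 1] suffices; the constant is that of
     [powR_le_expR]. *)
  have C0 : (0 < (p / exp_rate 1) `^ p)%R.
    by rewrite powR_gt0 // divr_gt0 // exp_rate_gt0.
  apply: le_lt_trans (integral_dG_bs_word w (phi := fun t => t `^ p) ltr01 C0 _ _) _.
  + by move=> t; exact: poweR_ge0.
  + move=> t M t0 tM; have M0 : (0 <= M)%R by rewrite -lee_fin (le_trans t0).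
    apply: (@le_trans _ _ (M%:E `^ p)).
      by apply: gt0_ler_poweR; rewrite ?(ltW p0) ?in_itv /= ?leey ?andbT.
    by rewrite poweR_EFin lee_fin powR_le_expR // exp_rate_gt0.
  + exact: ltry.
Qed.

End Integrability.

Theorem corollary8p2 (R : realType) :
  (exists (G L : groupType) (SG : set G) (SL : set L),
     [/\ finite_symmetric_generating SG,
         finite_symmetric_generating SL,
         finitely_presented L,
         ~ finitely_presented G &
         exists c : oe_coupling R G L,
           strongly_exp_integrable_lr SG SL c /\
           strongly_exp_integrable_rl SG SL c]) /\
  (exists (G L : groupType) (SG : set G) (SL : set L),
     [/\ finite_symmetric_generating SG,
         finite_symmetric_generating SL,
         finitely_presented L,
         ~ finitely_presented G &
         exists c : oe_coupling R G L,
           forall p : R, 1 <= p -> LpLp_integrable SG SL c p]).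
Proof.
split; exists lamp, bs, (range (letter lamp_gen)), (range (letter bs_gen)); split.
- exact/letters_finite_symmetric_generating/lamp_gen_surjective.
- exact/letters_finite_symmetric_generating/bs_gen_surjective.
- exact: bs_finitely_presented.
- exact: lamp_not_finitely_presented.
- exists (lamp_bs_coupling R); split; [exact: strongly_exp_lr|exact: strongly_exp_rl].
- exact/letters_finite_symmetric_generating/lamp_gen_surjective.
- exact/letters_finite_symmetric_generating/bs_gen_surjective.
- exact: bs_finitely_presented.
- exact: lamp_not_finitely_presented.
- by exists (lamp_bs_coupling R) => p; exact: lamp_bs_LpLp.
Qed.
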